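(* Let $G$ be a Lie group, let $K$ be a closed, normal Lie subgroup of $G$ of codimension 1 with Lie algebra $\mathfrak{K}$, let $g_0\in G$ be arbitrary, and let $\Sigma=Kg_0\subseteq G$ (a right coset of codimension 1). Let $\pi:G\to K\backslash G$ be the natural projection. Let $H:T^*G\to\mathbb{R}$ be a natural left-invariant Hamiltonian and let $h=H|_{\mathfrak{g}^*}$ be its restriction to the fiber over the identity. Suppose $(g(t),p(t))$ follows the hybrid flow $\varphi_t^{\mathcal{H}}$ of the mechanical impact system $(G,H,\Sigma)$, and let $\zeta(t)=(\ell_{g(t)})^*p(t)\in\mathfrak{g}^*$ and $q(t)=\pi(g(t))\in K\backslash G$. Let $\sigma:K\backslash G\to G$ be a local section of $\pi$ and let $\Delta\zeta\in\operatorname{Ann}(\mathfrak{K})$ be such that $h(\zeta)=h(\zeta+\Delta\zeta)$. Then the equations of motion can be written as $$\begin{cases}\dot\zeta=\operatorname{ad}^*_{dh}\zeta,\\ \dot q=d\pi_{\sigma(q)}\big(\ell_{\sigma(q)}\big)_*\zeta^\sharp,\end{cases}\quad q\notin\pi(\Sigma),\qquad\qquad \begin{cases}\zeta\mapsto\zeta+\Delta\zeta,\\ q\mapsto q,\end{cases}\quad q\in\pi(\Sigma).$$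
   Context: $\mathfrak{g}$ is the Lie algebra of $G$ and $\mathfrak{g}^*$ its dual; $\ell_g$ is left translation by $g$. $\operatorname{Ann}(\mathfrak{K})=\{\alpha\in\mathfrak{g}^*:\alpha|_{\mathfrak{K}}=0\}$. With $dh(\zeta)$ regarded as an element of $\mathfrak{g}\cong\mathfrak{g}^{**}$, $\operatorname{ad}^*_{dh}\zeta\in\mathfrak{g}^*$ is defined by $\operatorname{ad}^*_{dh}\zeta(\xi)=\zeta([dh,\xi])$. A Hamiltonian $H:T^*Q\to\mathbb{R}$ is natural if $H(q,p)=\tfrac12 m^{-1}_q(p,p)+V(q)$ for a Riemannian metric $m$ on $Q$ with induced co-metric $m^{-1}$ and a function $V:Q\to\mathbb{R}$. It is left-invariant (for $Q=G$) if it is invariant under the cotangent lift of left translations, i.e. $H(g,p)=H(e,\ell_g^*p)$ for all $g\in G$, $p\in T_g^*G$. For $\zeta\in\mathfrak{g}^*$, $\zeta^\sharp\in\mathfrak{g}$ is the vector with $m_e(\zeta^\sharp,\cdot)=\zeta$. Mechanical impact system $(Q,H,\Sigma)$: $H$ is a natural Hamiltonian on $T^*Q$ and $\Sigma\subset Q$ an orientable embedded codimension-1 submanifold, locally a regular level set $\{s=0\}$ of a smooth function $s$. It determines a hybrid dynamical system on $T^*Q$: away from the guard, trajectories are integral curves of the Hamiltonian vector field $X_H$ ($i_{X_H}\omega=dH$, with $\omega=dq^i\wedge dp_i$); the guard is the set of $(q,p)\in T^*Q|_\Sigma$ with $\pi_Q^*ds(X_H)>0$ (outward-pointing momenta, $\pi_Q:T^*Q\to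 Q$ the projection); and on the guard the state is reset by $(q,p^-)\mapsto(q,p^+)$, where $p^+$ solves the Weierstrass-Erdmann corner conditions $H(q,p^+)=H(q,p^-)$, $p^+-p^-=\varepsilon\,ds_q$ for a multiplier $\varepsilon\in\mathbb{R}$; for natural $H$ the reset is $p^+=p^--2\frac{m^{-1}(ds,p^-)}{m^{-1}(ds,ds)}ds$. The hybrid flow concatenates these continuous and discrete motions. *)

(* Defs.v *)
From HB Require Import structures.
From mathcomp Require Import all_boot all_order all_algebra.
From mathcomp Require Import all_classical all_reals all_analysis.
From mathcomp Require Import ring.

Set Implicit Arguments.
Unset Strict Implicit.
Unset Printing Implicit Defensive.

Import Order.TTheory GRing.Theory Num.Theory.
Import numFieldTopology.Exports numFieldNormedType.Exports.

Local Open Scope classical_set_scope.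
Local Open Scope ring_scope.

(** * Smooth maps between normed spaces *)

Fixpoint Ck_on (R : realType) (V W : normedModType R) (k : nat)
    (A : set V) (f : V -> W) : Prop :=
  if k is k'.+1 then
    (forall x, A x -> differentiable f x) /\
    (forall v : V, Ck_on k' A (fun x => 'D_v f x))
  else forall x, A x -> {for x, continuous f}.

Definition smooth_on (R : realType) (V W : normedModType R)
    (A : set V) (f : V -> W) : Prop :=
  forall k, Ck_on k A f.

Definition smooth_near (R : realType) (V W : normedModType R)
    (x : V) (f : V -> W) : Prop :=
  exists A : set V, [/\ open A, A x & smooth_on A f].

(** * Smooth manifolds *)

(* Both maps of a chart are total functions; only their values on the domain
   and on its image matter. *)
Record chart (R : realType) (n : nat) (M : topologicalType) := Chart {
  cdom : set M;
  cmap :> M -> 'rV[R]_n;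
  cinv : 'rV[R]_n -> M;
  cdom_open : open cdom;
  cimg_open : open (cmap @` cdom);
  cmapK : forall x, cdom x -> cinv (cmap x) = x;
  cmap_continuous : forall x, cdom x -> {for x, continuous cmap};
  cinv_continuous : forall x, cdom x -> {for cmap x, continuous cinv}
}.

(* The atlas is the range of [chart_at], which selects a preferred chart
   around each point. *)
HB.mixin Record isManifold (R : realType) (n : nat) M of Topological M := {
  chart_at : M -> chart R n M;
  mem_chart_at : forall x, cdom (chart_at x) x;
  chart_compat : forall x y : M,
    smooth_on (chart_at x @` (cdom (chart_at x) `&` cdom (chart_at y)))
              (chart_at y \o cinv (chart_at x));
  manifold_hausdorff : hausdorff_space M;
  manifold_second_countable : @second_countable M
}.

#[short(type="manifoldType")]
HB.structure Definition Manifold (R : realType) (n : nat) :=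
  {M of isManifold R n M & Topological M}.

(* T_xM is 'rV[R]_n and T_x^*M is 'cV[R]_n, in the coordinates of the
   preferred chart at x. Differentials act on tangent vectors on the right,
   v *m A, hence pull covectors back on the left, A *m p. *)

Definition pairing (R : realType) (n : nat) (p : 'cV[R]_n) (v : 'rV[R]_n) : R :=
  (v *m p) 0 0.

Section Calculus.
Context (R : realType) (n : nat) (M : manifoldType R n).

(* For tangent vectors at z: from coordinates in [chart_at x] to coordinates
   in [chart_at y]. *)
Definition transition (x y z : M) : 'M[R]_n :=
  jacobian (chart_at y \o cinv (chart_at x)) (chart_at x z).

Definition smooth_fun_near (x : M) (f : M -> R) : Prop :=
  smooth_near (chart_at x x) (f \o cinv (chart_at x) : 'rV[R]_n -> R^o).

Definition dfun (f : M -> R) (x : M) : 'cV[R]_n :=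
  \col_i 'd (f \o cinv (chart_at x) : 'rV[R]_n -> R^o) (chart_at x x)
            (delta_mx 0 i).

Definition local_rep (l : nat) (N : manifoldType R l) (f : M -> N) (x : M) :
    'rV[R]_n -> 'rV[R]_l :=
  chart_at (f x) \o f \o cinv (chart_at x).

Definition smooth_map_on (l : nat) (N : manifoldType R l)
    (U : set M) (f : M -> N) : Prop :=
  forall x, U x ->
    {for x, continuous f} /\ smooth_near (chart_at x x) (local_rep f x).

Definition tangent (l : nat) (N : manifoldType R l) (f : M -> N) (x : M) :
    'M[R]_(n, l) :=
  jacobian (local_rep f x) (chart_at x x).

Definition tangent_map (l : nat) (N : manifoldType R l) (f : M -> N) (x : M)
    (v : 'rV[R]_n) : 'rV[R]_l := v *m tangent f x.

Definition pullback (l : nat) (N : manifoldType R l) (f : M -> N) (x : M)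
    (p : 'cV[R]_l) : 'cV[R]_n := tangent f x *m p.

Definition field_in_chart (X : M -> 'rV[R]_n) (x : M) (u : 'rV[R]_n) :
    'rV[R]_n :=
  let y := cinv (chart_at x) u in X y *m transition y x y.

Definition field_bracket (X Y : M -> 'rV[R]_n) (x : M) : 'rV[R]_n :=
  'D_(X x) (field_in_chart Y x) (chart_at x x)
  - 'D_(Y x) (field_in_chart X x) (chart_at x x).

(** ** Curves on a time set I, possibly with endpoints *)

Definition derivative_within (V : normedModType R) (I : set R) (f : R -> V)
    (t : R) (df : V) : Prop :=
  (fun s : R => (s - t)^-1 *: (f s - f t)) @ within I t^' --> df.

Definition velocity_within (I : set R) (c : R -> M) (t : R) (v : 'rV[R]_n) :
    Prop :=
  c @ within I (nbhs t) --> c t /\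
  derivative_within I (fun s => chart_at (c t) (c s)) t v.

Definition tangent_space (S : set M) (x : M) : set 'rV[R]_n :=
  [set v | exists c : R -> M,
     [/\ c 0 = x, forall t, S (c t) & velocity_within setT c 0 v]].

(** ** Hypersurfaces *)

Definition defining_function (S : set M) (x : M) (s : M -> R) : Prop :=
  exists U : set M,
    [/\ open U, U x, forall y, U y -> smooth_fun_near y s,
        forall y, U y -> (S y <-> s y = 0)
      & forall y, U y -> S y -> dfun s y != 0].

Definition hypersurface (S : set M) : Prop :=
  forall x, S x -> exists s, defining_function S x s.

(* [s x] defines S around x; the local functions agree on which side of S is
   the outer one, which is what orients S. *)
Definition oriented_hypersurface (S : set M) (s : M -> M -> R) : Prop :=
  (forall x, S x -> defining_function S x (s x)) /\
  (forall x, S x -> \forall y \near x, S y ->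
     exists2 c : R, 0 < c & dfun (s y) y = c *: dfun (s x) y).

(** ** The cotangent bundle, as pairs (x, p) with p in T_x^*M *)

Definition ct_chart (x : M) (z : M * 'cV[R]_n) : 'rV[R]_n * 'cV[R]_n :=
  (chart_at x z.1 : 'rV[R]_n, transition x z.1 z.1 *m z.2).

Definition ct_chart_inv (x : M) (w : 'rV[R]_n * 'cV[R]_n) : M * 'cV[R]_n :=
  let y := cinv (chart_at x) w.1 in (y, transition y x y *m w.2).

Definition ct_velocity_within (I : set R) (c : R -> M * 'cV[R]_n) (t : R)
    (X : 'rV[R]_n * 'cV[R]_n) : Prop :=
  fst \o c @ within I (nbhs t) --> (c t).1 /\
  derivative_within I (fun s => ct_chart (c t).1 (c s)) t X.

Definition ct_cvg (F : set_system R) (c : R -> M * 'cV[R]_n)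
    (z : M * 'cV[R]_n) : Prop :=
  fst \o c @ F --> z.1 /\
  (fun s => ct_chart z.1 (c s)) @ F --> ct_chart z.1 z.

(* dq^i /\ dp_i *)
Definition omega (X Y : 'rV[R]_n * 'cV[R]_n) : R :=
  pairing Y.2 X.1 - pairing X.2 Y.1.

Definition hamiltonian_vector (H : M -> 'cV[R]_n -> R) (z : M * 'cV[R]_n)
    (X : 'rV[R]_n * 'cV[R]_n) : Prop :=
  let Hx : 'rV[R]_n * 'cV[R]_n -> R^o :=
    fun w => let y := ct_chart_inv z.1 w in H y.1 y.2 in
  differentiable Hx (ct_chart z.1 z) /\
  forall Y, omega X Y = 'd Hx (ct_chart z.1 z) Y.

(** ** Natural Hamiltonians *)

Definition metric (m : M -> 'M[R]_n) (x : M) (u v : 'rV[R]_n) : R :=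
  (u *m m x *m v^T) 0 0.

Definition riemannian (m : M -> 'M[R]_n) : Prop :=
  (forall x u v, metric m x u v = metric m x v u) /\
  (forall x v, v != 0 -> 0 < metric m x v v) /\
  (forall x, smooth_near (chart_at x x) (fun u : 'rV[R]_n =>
     let y := cinv (chart_at x) u in
     transition x y y *m m y *m (transition x y y)^T)).

Definition cometric (m : M -> 'M[R]_n) (x : M) (p r : 'cV[R]_n) : R :=
  (p^T *m invmx (m x) *m r) 0 0.

Definition sharp (m : M -> 'M[R]_n) (x : M) (p : 'cV[R]_n) : 'rV[R]_n :=
  p^T *m invmx (m x).

Definition natural_hamiltonian (m : M -> 'M[R]_n) (V : M -> R)
    (H : M -> 'cV[R]_n -> R) : Prop :=
  riemannian m /\ forall x p, H x p = 2^-1 * cometric m x p p + V x.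

(** ** Mechanical impact systems *)

Definition mechanical_impact_system (m : M -> 'M[R]_n) (V : M -> R)
    (H : M -> 'cV[R]_n -> R) (S : set M) (s : M -> M -> R) : Prop :=
  natural_hamiltonian m V H /\ oriented_hypersurface S s.

Definition guard (H : M -> 'cV[R]_n -> R) (S : set M) (s : M -> M -> R)
    (z : M * 'cV[R]_n) : Prop :=
  S z.1 /\
  exists2 X, hamiltonian_vector H z X & 0 < pairing (dfun (s z.1) z.1) X.1.

Definition reset (m : M -> 'M[R]_n) (s : M -> M -> R) (z : M * 'cV[R]_n) :
    M * 'cV[R]_n :=
  let ds := dfun (s z.1) z.1 in
  (z.1, z.2 - (2 * (cometric m z.1 ds z.2 / cometric m z.1 ds ds)) *: ds).

Definition corner_conditions (H : M -> 'cV[R]_n -> R) (ds : 'cV[R]_n) (x : M)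
    (p p' : 'cV[R]_n) : Prop :=
  H x p' = H x p /\ exists eps : R, p' - p = eps *: ds.

(* The state at a reset time is the one before the reset, so trajectories are
   left-continuous and the reset state is the limit from the right. *)
Definition hybrid_trajectory (m : M -> 'M[R]_n) (H : M -> 'cV[R]_n -> R)
    (S : set M) (s : M -> M -> R) (I : set R) (c : R -> M * 'cV[R]_n) : Prop :=
  forall t, I t ->
    (~ guard H S s (c t) ->
       exists2 X, hamiltonian_vector H (c t) X & ct_velocity_within I c t X) /\
    (guard H S s (c t) ->
       ct_cvg (within I t^'-) c (c t) /\
       ct_cvg (within I t^'+) c (reset m s (c t))).

End Calculus.

(** * The reset is the nontrivial solution of the corner conditions *)

Lemma resetP (R : realType) (n : nat) (M : manifoldType R n)
    (m : M -> 'M[R]_n) (V : M -> R) (H : M -> 'cV[R]_n -> R)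
    (s : M -> M -> R) (x : M) (p p' : 'cV[R]_n) :
  natural_hamiltonian m V H ->
  cometric m x (dfun (s x) x) p != 0 ->
  (corner_conditions H (dfun (s x) x) x p p' /\ p' <> p) <->
  (x, p') = reset m s (x, p).
Proof.
Proof.
move=> [[msym [mpos _]] HE].
rewrite /corner_conditions /reset /=; set d := dfun _ _ => Cdp.
have mT : (m x)^T = m x.
  apply/matrixP => i j; rewrite mxE.
  have E k l : metric m x (delta_mx 0 k) (delta_mx 0 l) = m x k l.
    by rewrite /metric -rowE trmx_delta -colE !mxE.
  by rewrite -!E msym.
have mU : m x \in unitmx.
  rewrite -row_free_unit -kermx_eq0; apply/eqP/row_matrixP => i.
  rewrite row0; apply/eqP/negP => /negP/(mpos x).
  by rewrite /metric -row_mul mulmx_ker row0 mul0mx mxE ltxx.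
have Csym a b : cometric m x a b = cometric m x b a.
  have -> : cometric m x a b = (a^T *m invmx (m x) *m b)^T 0 0 by rewrite mxE.
  by rewrite !trmx_mul trmxK trmx_inv mT mulmxA.
have CD e : cometric m x (p + e *: d) (p + e *: d) =
    cometric m x p p + e * (2 * cometric m x d p + e * cometric m x d d).
  have -> : cometric m x (p + e *: d) (p + e *: d) =
      cometric m x p p + e * cometric m x p d + e * cometric m x d p
      + e * (e * cometric m x d d).
    have T : (p + e *: d)^T = p^T + e *: d^T by rewrite linearD linearZ.
    rewrite /cometric T !mulmxDl !mulmxDr -!scalemxAl.
    by rewrite -!scalemxAr !mxE; ring.
  by rewrite (Csym p d); ring.
have d0 : d != 0.
  by apply: contraNneq Cdp => ->; rewrite /cometric trmx0 !mul0mx mxE.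
have Cdd : 0 < cometric m x d d.
  have := mpos x (d^T *m invmx (m x)); rewrite /metric.
  rewrite trmx_mul trmxK trmx_inv mT !mulmxA mulmxKV //; apply.
  apply: contra d0 => /eqP E; rewrite -(trmxK d).
  by rewrite -(mulmxKV mU d^T) E mul0mx trmx0.
split=> [[[Hp' [e pe]] pp']|[->]]; last first.
  split; last first.
    move/eqP; rewrite -subr_eq0 addrC addKr oppr_eq0 scaler_eq0 (negPf d0).
    by rewrite orbF !mulf_eq0 invr_eq0 (negPf Cdp) (gt_eqF Cdd) pnatr_eq0.
  split; last first.
    by eexists; rewrite addrC addKr -scaleNr; reflexivity.
  rewrite -scaleNr !HE CD; congr (_ * _ + _).
  rewrite -[RHS]addr0; congr (_ + _).
  by field; rewrite (gt_eqF Cdd).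
have {pe} p'E : p' = p + e *: d by rewrite -pe addrC subrK.
have e0 : e != 0 by apply/eqP => e0; apply: pp'; rewrite p'E e0 scale0r addr0.
move: Hp'; rewrite !HE p'E CD => /addIr /mulfI.
rewrite invr_eq0 pnatr_eq0 => /(_ isT) /eqP.
rewrite -[X in _ == X]addr0 (inj_eq (addrI _)) mulf_eq0 (negPf e0) /= => /eqP E.
congr (_, _ + _); rewrite -scaleNr; congr (_ *: _).
have -> : cometric m x d p = - (e * cometric m x d d) / 2.
  by move: E => /eqP; rewrite addr_eq0 => /eqP <-; field.
by field; rewrite (gt_eqF Cdd).
Qed.

(** * Lie groups *)

HB.mixin Record isLieGroup (R : realType) (n : nat) G
    of Manifold R n G & Group G := {
  lie_mul_continuous : continuous (fun z : G * G => (z.1 * z.2)%g);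
  lie_mul_smooth : forall x y : G,
    smooth_near (chart_at x x : 'rV[R]_n, chart_at y y : 'rV[R]_n)
      (fun w : 'rV[R]_n * 'rV[R]_n =>
         chart_at (x * y)%g (cinv (chart_at x) w.1 * cinv (chart_at y) w.2)%g
         : 'rV[R]_n);
  lie_inv_smooth : smooth_map_on setT (fun x : G => (x^-1)%g)
}.

#[short(type="lieGroupType")]
HB.structure Definition LieGroup (R : realType) (n : nat) :=
  {G of isLieGroup R n G & Manifold R n G & Group G}.

Section LieGroups.
Context (R : realType) (n : nat) (G : lieGroupType R n).

Definition ltrans (g x : G) : G := (g * x)%g.

Definition left_field (xi : 'rV[R]_n) (g : G) : 'rV[R]_n :=
  tangent_map (ltrans g) 1%g xi.

Definition lie_bracket (xi eta : 'rV[R]_n) : 'rV[R]_n :=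
  field_bracket (left_field xi) (left_field eta) 1%g.

(* The functional eta |-> zeta [xi, eta], given by its values on a basis. *)
Definition ad_star (xi : 'rV[R]_n) (zeta : 'cV[R]_n) : 'cV[R]_n :=
  \col_i pairing zeta (lie_bracket xi (delta_mx 0 i)).

(* dh(zeta), as the vector v such that dh(zeta)(b) = b(v). *)
Definition codifferential (h : 'cV[R]_n -> R) (zeta : 'cV[R]_n) : 'rV[R]_n :=
  \row_i 'd (h : 'cV[R]_n -> R^o) zeta (delta_mx i 0).

Definition left_invariant (H : G -> 'cV[R]_n -> R) : Prop :=
  forall g p, H g p = H 1%g (pullback (ltrans g) 1%g p).

Definition normal_subgroup (K : set G) : Prop :=
  [/\ K 1%g, forall x y, K x -> K y -> K (x * y)%g,
      forall x, K x -> K (x^-1)%g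
    & forall g x, K x -> K (g * x * g^-1)%g].

Definition closed_normal_lie_subgroup_codim1 (K : set G) : Prop :=
  [/\ closed K, normal_subgroup K & hypersurface K].

Definition right_coset (K : set G) (g : G) : set G :=
  [set x | exists2 k, K k & x = (k * g)%g].

Definition annihilator (K : set G) : set 'cV[R]_n :=
  [set a | forall xi, tangent_space K 1%g xi -> pairing a xi = 0].

(* The carrier and the smooth structure of K\G are determined up to
   diffeomorphism by the projection being a surjective submersion whose fibres
   are the right cosets. *)
Definition quotient_projection (K : set G) (l : nat) (M : manifoldType R l)
    (pi : G -> M) : Prop :=
  [/\ smooth_map_on setT pi, forall y, exists x, pi x = y,
      forall x (w : 'rV[R]_l), exists v, tangent_map pi x v = w
    & forall x y, pi x = pi y <-> right_coset K x y].

Definition local_section (l : nat) (M : manifoldType R l) (pi : G -> M)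
    (U : set M) (sigma : M -> G) : Prop :=
  [/\ open U, smooth_map_on U sigma & forall y, U y -> pi (sigma y) = y].

Definition impulse (K : set G) (h : 'cV[R]_n -> R) (zeta d : 'cV[R]_n) :
    Prop :=
  annihilator K d /\ h zeta = h (zeta + d).

End LieGroups.

(* Main.v *)
(* Left trivialization turns the cotangent dynamics into a computation with the
   matrix A(u) of the differential of L_y at 1, read in a chart: in a chart
   around g the momentum is zeta = A(u) p and, by left-invariance, H = h(A(u) p).
   Hamilton's equations then give u' = xi A and
   zeta'(eta) = (eta dA(xi A) - xi dA(eta A)) p with xi = dh(zeta), and the last
   bracket is [xi, eta] A p: differentiating A(L_g u) = A(u) J(L_g)(u) at u = 1
   shows that left-invariant fields bracket left-invariantly, the second
   derivatives of L_g cancelling by symmetry. The equation for q holds because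
   pi o L_g = pi o L_sigma when pi g = pi sigma.
   At an impact, normality of K makes x |-> s(g x) a defining function of K
   around 1, so the pullback W of ds annihilates the Lie algebra of K, and Ann(K)
   is the line spanned by W. Thus the elements of Ann(K) preserving h correspond
   to the solutions of the corner conditions, of which the reset is the only
   nontrivial one. *)
Require Import Defs.
From HB Require Import structures.
From mathcomp Require Import all_boot all_order all_algebra.
From mathcomp Require Import all_classical all_reals all_analysis.
From mathcomp Require Import ring lra.

Set Implicit Arguments.
Unset Strict Implicit.
Unset Printing Implicit Defensive.

Import Order.TTheory GRing.Theory Num.Theory.
Import numFieldTopology.Exports numFieldNormedType.Exports.

Local Open Scope classical_set_scope.
Local Open Scope ring_scope.

(** * Differential calculus in normed spaces and along curves on a time set *)

Section Calc.
Context (R : realType).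

(** The first-order expansion at [x] only involves values near [x], so [g] inherits the expansion of
    [f]; uniqueness of the linear part of such an expansion then identifies the two
    differentials. *)
Lemma near_eq_is_diff (V W : normedModType R) (f g df : V -> W) (x : V) :
  {near x, f =1 g} -> is_diff x f df -> is_diff x g df.
Proof.
move=> fg [fd dfE].
have fgx : f x = g x by exact: (nbhs_singleton fg).
have E : g \o shift x = cst (g x) + 'd f x +o_ 0 id.
  apply/eqaddoP => e e0.
  move/diff_locally : (fd) => /eqaddoP/(_ e e0).
  have : \forall y \near 0, f (y + x) = g (y + x).
    by move: fg; rewrite (near_shift 0 x) subr0; apply: filterS.
  apply: filterS2 => y; rewrite -fgx.
  by rewrite ![(_ + _ : _ -> _) _]/(_ + _) ![(- _ : _ -> _) _]/(- _) /= => ->.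
have dc : continuous ('d f x) by exact: diff_continuous.
have dg := diff_unique dc E.
by apply: DiffDef; [apply/diff_locallyP; rewrite dg|rewrite dg].
Qed.

Lemma near_eq_differentiable (V W : normedModType R) (f g : V -> W) (x : V) :
  {near x, f =1 g} -> differentiable f x -> differentiable g x.
Proof. by move=> fg /differentiableP fd; have [] := near_eq_is_diff fg fd. Qed.

Lemma near_eq_diff (V W : normedModType R) (f g : V -> W) (x : V) :
  {near x, f =1 g} -> differentiable f x -> 'd g x = 'd f x :> (V -> W).
Proof. by move=> fg /differentiableP fd; have [] := near_eq_is_diff fg fd. Qed.

Lemma row_jacobian (m n : nat) (f : 'rV[R]_m -> 'rV[R]_n) (x : 'rV[R]_m) i :
  differentiable f x -> row i (jacobian f x) = 'D_(delta_mx 0 i) f x.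
Proof. by move=> fd; rewrite rowE (deriveEjacobian _ fd). Qed.

Lemma near_eq_jacobian (m n : nat) (f g : 'rV[R]_m -> 'rV[R]_n) (x : 'rV[R]_m) :
  {near x, f =1 g} -> differentiable f x -> jacobian g x = jacobian f x.
Proof.
move=> fg fd; have gd := near_eq_differentiable fg fd.
apply/row_matrixP => i; apply: etrans (row_jacobian i gd) _.
by apply: etrans _ (esym (row_jacobian i fd)); rewrite (near_eq_derive _ fg).
Qed.

Lemma jacobian_comp (l m n : nat) (f : 'rV[R]_l -> 'rV[R]_m)
    (g : 'rV[R]_m -> 'rV[R]_n) (x : 'rV[R]_l) :
  differentiable f x -> differentiable g (f x) ->
  jacobian (g \o f) x = jacobian f x *m jacobian g (f x).
Proof.
move=> fd gd; have gfd := differentiable_comp fd gd.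
apply/row_matrixP => i; apply: etrans (row_jacobian i gfd) _.
rewrite row_mul (row_jacobian i fd) -(deriveEjacobian _ gd).
by rewrite (deriveE _ gfd) (deriveE _ fd) (deriveE _ gd) (diff_comp fd gd).
Qed.

Lemma jacobian_id (m : nat) (x : 'rV[R]_m) : jacobian id x = 1%:M.
Proof.
have [idd E] := is_diff_id x; apply/row_matrixP => i.
by apply: etrans (row_jacobian i idd) _; rewrite (deriveE _ idd) E rowE mulmx1.
Qed.

Lemma cvg_pairl (U V : topologicalType) (u : U) (v : V) :
  (u', v) @[u' --> u] --> (u, v).
Proof. by apply: cvg_pair => //=; exact: cvg_cst. Qed.

Lemma differentiable_pair1 (U V : normedModType R) (u : U) (v : V) :
  differentiable (fun u' : U => (u', v) : U * V) u.
Proof. by have [] := is_diff_pair (is_diff_id u) (is_diff_cst v u). Qed.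

Lemma differentiable_pair2 (U V : normedModType R) (u : U) (v : V) :
  differentiable (fun v' : V => (u, v') : U * V) v.
Proof. by have [] := is_diff_pair (is_diff_cst u v) (is_diff_id v). Qed.

Lemma derive_pairr (U V W : normedModType R) (f : U * V -> W) (u : U)
    (v w : V) :
  'D_w (fun v => f (u, v)) v = 'D_((0 : U), w) f (u, v).
Proof.
rewrite /derive; set d1 := fun h : R => _; set d2 := fun h : R => _.
suff -> : d1 = d2 by []; apply/funext => h; rewrite /d1 /d2 /=.
by congr (_ *: (f _ - _)); congr (_, _); rewrite /= scaler0 add0r.
Qed.

Lemma cvg_mx (T : Type) (F : set_system T) (FF : Filter F) (m n : nat)
    (f : T -> 'M[R]_(m, n)) (l : 'M[R]_(m, n)) :
  (forall i j, (fun x => f x i j) @ F --> l i j) -> f @ F --> l.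
Proof.
move=> fl; apply/cvgrPdist_le => e e0; near=> x.
rewrite /Num.Def.normr/= mx_normrE (bigmax_le _ (ltW e0))//= => i _.
rewrite !mxE/=; move: i; near: x.
apply: filter_forall => /= i.
exact: ((cvgrPdist_le _ _).1 (fl i.1 i.2)).
Unshelve. all: by end_near. Qed.

Lemma mulmx_continuous (l m n : nat) :
  continuous (fun p : 'M[R]_(l, m) * 'M[R]_(m, n) => p.1 *m p.2).
Proof.
move=> p; apply: cvg_mx => i j.
under eq_fun do rewrite mxE; rewrite mxE.
apply: cvg_big => [|k _]; first exact: add_continuous.
apply: cvgM.
  apply: (cvg_comp (@fst _ _) (fun M : 'M[R]_(l, m) => M i k) cvg_fst).
  exact: coord_continuous.
apply: (cvg_comp (@snd _ _) (fun M : 'M[R]_(m, n) => M k j) cvg_snd).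
exact: coord_continuous.
Qed.

Lemma mulmx_is_bilinear (l m n : nat) :
  bilinear_for
    (GRing.Scale.Law.clone R _ *:%R _) (GRing.Scale.Law.clone R _ *:%R _)
    (@mulmx R l m n).
Proof.
split=> [u'|u] a x y /=; first by rewrite mulmxDl scalemxAl.
by rewrite mulmxDr scalemxAr.
Qed.
HB.instance Definition _ (l m n : nat) :=
  bilinear_isBilinear.Build R 'M[R]_(l, m) 'M[R]_(m, n) 'M[R]_(l, n) _ _
  (@mulmx R l m n) (@mulmx_is_bilinear l m n).

Lemma is_diff_mulmx (V : normedModType R) (l m n : nat)
    (A dA : V -> 'M[R]_(l, m)) (B dB : V -> 'M[R]_(m, n)) (x : V) :
  is_diff x A dA -> is_diff x B dB ->
  is_diff x (fun y => A y *m B y) (fun v => A x *m dB v + dA v *m B x).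
Proof.
move=> dfA dfB.
have M : is_diff (A x, B x) (fun q : 'M[R]_(l, m) * 'M[R]_(m, n) => q.1 *m q.2)
   (fun q => A x *m q.2 + q.1 *m B x).
  apply: DiffDef; first exact/differentiable_bilin/mulmx_continuous.
  by rewrite diff_bilin //; exact/mulmx_continuous.
by have := @is_diff_comp _ _ _ _ (fun y => (A y, B y)) _ _ _ _
  (is_diff_pair dfA dfB) M.
Qed.

Lemma is_diff_coord (m n : nat) (M : 'M[R]_(m, n)) i j :
  is_diff M (fun N : 'M[R]_(m, n) => N i j : R^o) (fun N => N i j).
Proof.
have cL : linear (fun N : 'M[R]_(m, n) => N i j : R^o).
  by move=> a A B; rewrite !mxE.
pose cM := GRing.isLinear.Build _ _ _ _ _ cL.
pose c : {linear _ -> _} := HB.pack (fun N : 'M[R]_(m, n) => N i j : R^o) cM.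
have cc : continuous c by exact: coord_continuous.
apply: (@DiffDef _ _ _ _ _ c c); first exact: linear_differentiable.
exact: diff_lin.
Qed.

Lemma is_diff_trmx (m n : nat) (M : 'M[R]_(m, n)) :
  is_diff M (@trmx R m n) (@trmx R m n).
Proof.
have tc : continuous (@trmx R m n).
  move=> A; apply: (@cvg_mx _ (nbhs A) _) => i j.
  have -> : (fun B : 'M[R]_(m, n) => B^T i j) = (fun B => B j i).
    by apply/funext => B; rewrite mxE.
  by rewrite mxE; exact: coord_continuous.
by apply: DiffDef; [exact: linear_differentiable|exact: diff_lin].
Qed.

Lemma is_diff_fst (U V : normedModType R) (w : U * V) : is_diff w fst fst.
Proof.
have c : continuous (@fst U V) by move=> x; exact: cvg_fst.
by apply: DiffDef; [exact: linear_differentiable|exact: diff_lin].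
Qed.

Lemma is_diff_snd (U V : normedModType R) (w : U * V) : is_diff w snd snd.
Proof.
have c : continuous (@snd U V) by move=> x; exact: cvg_snd.
by apply: DiffDef; [exact: linear_differentiable|exact: diff_lin].
Qed.

Lemma row_pairing_inj (n : nat) (u v : 'rV[R]_n) :
  (forall b : 'cV[R]_n, (u *m b) 0 0 = (v *m b) 0 0) -> u = v.
Proof.
by move=> uv; apply/rowP => i; have := uv (delta_mx i 0); rewrite -!colE !mxE.
Qed.

Lemma differentiable_mx (V : normedModType R) (m n : nat)
    (f : V -> 'M[R]_(m, n)) (x : V) :
  (forall i j, differentiable (fun y => f y i j : R^o) x) -> differentiable f x.
Proof.
move=> fd; have -> : f =
    \sum_(i < m) \sum_(j < n) (fun y => f y i j *: delta_mx i j).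
  apply/funext => y; rewrite {1}[f y]matrix_sum_delta fct_sumE.
  by apply: eq_bigr => i _; rewrite fct_sumE.
apply: differentiable_sum => i; apply: differentiable_sum => j.
exact: differentiableZl.
Qed.

(** The increment is the factor [s - t], which tends to 0, times the difference quotient, which
    converges. *)
Lemma derivative_within_cvg (V : normedModType R) (I : set R)
    (c : R -> V) (t : R) (v : V) :
  derivative_within I c t v -> c s @[s --> within I t^'] --> c t.
Proof.
move=> cv; apply/subr_cvg0.
have : (s - t) *: ((s - t)^-1 *: (c s - c t)) @[s --> within I t^'] -->
    (0 : R) *: v.
  apply: cvgZ => //; rewrite -(subrr t); apply: cvgB; last exact: cvg_cst.
  by do 2 apply: cvg_within_filter; exact: cvg_id.
rewrite scale0r; apply: cvg_trans; apply: near_eq_cvg.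
near=> s; rewrite scalerA divff ?scale1r // subr_eq0.
by near: s; apply: cvg_within; exact: withinT.
Unshelve. all: by end_near. Qed.

(** The quotient of [f \o c] is the differential applied to the quotient [dq] of [c], plus the
    remainder of [f] divided by [s - t]. The remainder vanishes in the limit because [dq] stays
    bounded. *)
Lemma derivative_within_comp (V W : normedModType R) (I : set R) (c : R -> V)
    (f : V -> W) (t : R) (v : V) :
  differentiable f (c t) -> derivative_within I c t v ->
  derivative_within I (fun s => f (c s)) t ('d f (c t) v).
Proof.
move=> fd cv.
have cc : c s - c t @[s --> within I t^'] --> (0 : V).
  exact/subr_cvg0/(derivative_within_cvg cv).
pose df := 'd f (c t); pose dq s := (s - t)^-1 *: (c s - c t).
pose r s := (s - t)^-1 *: (f (c s) - f (c t)) - df (dq s).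
have r0 : r s @[s --> within I t^'] --> (0 : W).
  apply/cvgr0Pnorm_le => e e0.
  have p0 : 0 < `|v| + 1 by rewrite ltr_wpDl.
  have e'0 : 0 < e / (`|v| + 1) by rewrite divr_gt0.
  move/diff_locally : (fd) => /eqaddoP/(_ _ e'0) fo.
  have cfo : \forall s \near within I t^',
      `|f (c s) - (f (c t) + df (c s - c t))| <=
      e / (`|v| + 1) * `|c s - c t|.
    have := cc _ fo; apply: (@filterS _ (within I t^')) => s.
    by rewrite !fctE /= subrK.
  have cv1 : \forall s \near within I t^', `|dq s| <= `|v| + 1.
    move/cvgrPdist_le : (cv) => /(_ 1 ltr01).
    apply: (@filterS _ (within I t^')) => s.
    rewrite distrC -/(dq s) => h; rewrite -(subrKC v (dq s)).
    by rewrite (le_trans (ler_normD _ _)) // lerD2l.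
  move: cfo cv1; apply: (@filterS2 _ (within I t^')) => s fs ds.
  rewrite /r /dq linearZ -scalerBr normrZ.
  have -> : f (c s) - f (c t) - df (c s - c t) =
      f (c s) - (f (c t) + df (c s - c t)).
    by rewrite opprD addrA.
  apply: (le_trans (ler_wpM2l (normr_ge0 _) fs)).
  rewrite mulrCA -normrZ -/(dq s) -[leRHS](divfK (lt0r_neq0 p0)).
  by rewrite ler_wpM2l // ltW.
have dfc : df (dq s) @[s --> within I t^'] --> df v.
  by apply: (cvg_comp dq df cv); exact: diff_continuous.
have E : (fun s => (s - t)^-1 *: (f (c s) - f (c t))) =
    (fun s => r s + df (dq s)).
  by apply/funext => s; rewrite /r /= subrK.
rewrite /derivative_within E -[X in _ --> X]add0r; exact: cvgD r0 dfc.
Unshelve. all: by end_near. Qed.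

Lemma derivative_within_near_eq (V : normedModType R) (I : set R)
    (f g : R -> V) (t : R) (v : V) :
  (\forall s \near within I t^', f s = g s) -> f t = g t ->
  derivative_within I f t v -> derivative_within I g t v.
Proof.
move=> fg fgt; rewrite /derivative_within fgt; apply: cvg_trans.
by apply: near_eq_cvg; move: fg; apply: (@filterS _ (within I t^')) => s /= ->.
Qed.

End Calc.

(** * Symmetry of second derivatives *)

Section Schwarz.
Context (R : realType) (V : normedModType R).

Lemma is_derive_line (f : V -> R^o) (z v : V) (a l : R) :
  is_derive (z + a *: v) v f l ->
  is_derive a 1 (fun b : R => f (z + b *: v) : R^o) l.
Proof.
suff E : (fun h : R => h^-1 *: (((fun b : R => f (z + b *: v) : R^o) \o shift a)
      (h *: 1) - f (z + a *: v))) =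
    (fun h : R =>
       h^-1 *: ((f \o shift (z + a *: v)) (h *: v) - f (z + a *: v))).
  move=> [f1 f2]; apply: DeriveDef; first by rewrite /derivable E.
  by rewrite /derive E.
apply/funext => h /=; congr (_ *: (f _ - _)).
by rewrite [h *: 1]mulr1 scalerDl addrCA.
Qed.

(** The mean value theorem is used twice: in the direction [v] for the difference of [f] along two
    opposite edges of the parallelogram, then in the direction [w] for [fv]. *)
Lemma second_difference (f fv fvw : V -> R^o) (x v w : V) (h : R) : 0 <= h ->
  (forall a b : R, 0 <= a <= h -> 0 <= b <= h ->
     let y := x + b *: w + a *: v in
     is_derive y v f (fv y) /\ is_derive y w fv (fvw y)) ->
  exists a b : R, [/\ 0 <= a <= h, 0 <= b <= h &
    f (x + h *: v + h *: w) - f (x + h *: v) - (f (x + h *: w) - f x) =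
    fvw (x + b *: w + a *: v) * h * h].
Proof.
move=> h0 D.
have hh : 0 <= h <= h by rewrite h0 lexx.
have zz : 0 <= (0 : R) <= h by rewrite lexx h0.
(* The term [0 *: w] gives both edges the form in which [D] applies, with [b] equal to [h] and to
   0. *)
pose psi (a : R) := f (x + h *: w + a *: v) - f (x + 0 *: w + a *: v) : R^o.
pose dpsi (a : R) := fv (x + h *: w + a *: v) - fv (x + 0 *: w + a *: v) : R^o.
have psiD a : 0 <= a <= h -> is_derive a 1 (psi : R^o -> R^o) (dpsi a).
  move=> ah; apply: is_deriveB; apply: is_derive_line.
    by have [] := D _ _ ah hh.
  by have [] := D _ _ ah zz.
have [] := @MVT_segment R psi dpsi 0 h h0.
- by move=> a; rewrite in_itv /= => /andP[a0 ah]; apply: psiD; rewrite !ltW.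
- apply: continuous_in_subspaceT => a; rewrite inE /= in_itv /= => ah.
  by apply/differentiable_continuous/derivable1_diffP; have [] := psiD _ ah.
move=> a; rewrite in_itv /= => ah.
pose chi (b : R) := fv (x + a *: v + b *: w) : R^o.
pose dchi (b : R) := fvw (x + a *: v + b *: w) : R^o.
have chiD b : 0 <= b <= h -> is_derive b 1 (chi : R^o -> R^o) (dchi b).
  move=> bh; apply: is_derive_line; rewrite addrAC.
  by have [] := D _ _ ah bh; rewrite /dchi (addrAC x (b *: w)).
have [] := @MVT_segment R chi dchi 0 h h0.
- by move=> b; rewrite in_itv /= => /andP[b0 bh]; apply: chiD; rewrite !ltW.
- apply: continuous_in_subspaceT => b; rewrite inE /= in_itv /= => bh.
  by apply/differentiable_continuous/derivable1_diffP; have [] := chiD _ bh.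
move=> b; rewrite in_itv /= => bh E1 E2.
exists a, b; split => //; move: E1 E2.
rewrite /psi /dpsi /chi /dchi !scale0r !addr0 subr0 => E1 E2.
rewrite (addrAC x (h *: v) (h *: w)) E2 (addrAC x (h *: w) (a *: v)) E1.
by rewrite (addrAC x (b *: w) (a *: v)).
Qed.

(** The second difference of [f] over a parallelogram is symmetric in [v] and [w]. Divided by the
    square of [h] it is a value of [fvw] and also a value of [fwv], both taken near [x]; continuity
    brings both values close to those at [x]. *)
Lemma derive_derive_comm_real (f fv fw fvw fwv : V -> R^o) (x v w : V) :
  (\forall y \near x, is_derive y v f (fv y)) ->
  (\forall y \near x, is_derive y w f (fw y)) ->
  (\forall y \near x, is_derive y w fv (fvw y)) ->
  (\forall y \near x, is_derive y v fw (fwv y)) ->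
  {for x, continuous fvw} -> {for x, continuous fwv} -> fvw x = fwv x.
Proof.
move=> Hv Hw Hvw Hwv Cvw Cwv.
apply/eqP; rewrite -subr_eq0 -normr_eq0 eq_le normr_ge0 andbT.
apply/ler_addgt0Pr => e e0; rewrite add0r.
have e20 : 0 < e / 2 by rewrite divr_gt0.
move/cvgrPdist_lt : Cvw => /(_ _ e20) Cvw.
move/cvgrPdist_lt : Cwv => /(_ _ e20) Cwv.
pose P y := [/\ is_derive y v f (fv y), is_derive y w f (fw y),
  is_derive y w fv (fvw y), is_derive y v fw (fwv y)
  & `|fvw x - fvw y| < e / 2 /\ `|fwv x - fwv y| < e / 2].
have [r /= r0 Hr] : exists2 r : R, 0 < r & forall y, `|y - x| < r -> P y.
  have : \forall y \near x, P y by near=> y; split; [| | | |split]; near: y.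
  move=> /nbhs_normP[r /= r0 Hr]; exists r => // y yx; apply: Hr => /=.
  by rewrite distrC.
(* With this side length the whole parallelogram stays within [r] of [x]; the summand 1 covers the
   case where both vectors vanish. *)
pose h := r / (`|v| + `|w| + 1).
have p0 : 0 < `|v| + `|w| + 1 by rewrite ltr_wpDl // addr_ge0.
have h0 : 0 < h by rewrite divr_gt0.
have hlt : h * (`|v| + `|w|) < r.
  rewrite /h mulrAC ltr_pdivrMr // mulrC; rewrite -subr_gt0.
  by rewrite mulrDr mulr1 (mulrC r) addrC addKr.
have nr (v' w' : V) a b : `|v'| + `|w'| = `|v| + `|w| ->
    0 <= a <= h -> 0 <= b <= h -> `|x + b *: w' + a *: v' - x| < r.
  move=> vw /andP[a0 ah] /andP[b0 bh]; rewrite -(addrA x) (addrC x) addrK.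
  apply: le_lt_trans hlt; rewrite -vw (le_trans (ler_normD _ _))//.
  rewrite !normrZ (ger0_norm a0) (ger0_norm b0) mulrDr addrC.
  by rewrite lerD // ler_wpM2r.
have [a [b [ah bh E]]] : exists a b : R, [/\ 0 <= a <= h, 0 <= b <= h &
    f (x + h *: v + h *: w) - f (x + h *: v) - (f (x + h *: w) - f x) =
    fvw (x + b *: w + a *: v) * h * h].
  apply: (@second_difference f fv); first exact: ltW.
  by move=> a b ah bh y; have [] := Hr y (nr v w _ _ erefl ah bh).
have [a' [b' [ah' bh' E']]] : exists a b : R, [/\ 0 <= a <= h, 0 <= b <= h &
    f (x + h *: w + h *: v) - f (x + h *: w) - (f (x + h *: v) - f x) =
    fwv (x + b *: v + a *: w) * h * h].
  apply: (@second_difference f fw); first exact: ltW.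
  by move=> a' b' ah' bh' y; have [] := Hr y (nr w v _ _ (addrC _ _) ah' bh').
have EE : fvw (x + b *: w + a *: v) = fwv (x + b' *: v + a' *: w).
  apply: (mulIf (lt0r_neq0 h0)); apply: (mulIf (lt0r_neq0 h0)).
  by rewrite -E -E' (addrAC x (h *: w)) !opprB !addrA; ring.
have [_ _ _ _ [l1 _]] := Hr _ (nr v w _ _ erefl ah bh).
have [_ _ _ _ [_ l2]] := Hr _ (nr w v _ _ (addrC _ _) ah' bh').
rewrite -(subrKA (fvw (x + b *: w + a *: v))) (splitr e).
apply: (le_trans (ler_normD _ _)); rewrite lerD // ?ltW //.
by rewrite EE distrC.
Unshelve. all: by end_near. Qed.

Lemma smooth_near_differentiable (W : normedModType R) (f : V -> W) (x : V) :
  smooth_near x f -> \forall y \near x, differentiable f y.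
Proof.
move=> [A [Ao Ax sf]]; have [fd _] := sf 1.
by apply: filterS (open_nbhs_nbhs (conj Ao Ax)) => y; exact: fd.
Qed.

Lemma smooth_near_derive (W : normedModType R) (f : V -> W) (x v : V) :
  smooth_near x f -> smooth_near x ('D_v f).
Proof.
move=> [A [Ao Ax sf]]; exists A; split => // k.
by have [_] := sf k.+1; apply.
Qed.

Lemma derive_derive_comm (m n : nat) (f : V -> 'M[R]_(m, n)) (x v w : V) :
  smooth_near x f -> 'D_w ('D_v f) x = 'D_v ('D_w f) x.
Proof.
move=> sf; apply/matrixP => i j.
have coordD (g : V -> 'M[R]_(m, n)) y u : differentiable g y ->
    is_derive y u (fun z => g z i j : R^o) ('D_u g y i j).
  move=> gd; have gu : derivable g y u := diff_derivable gd.
  have gij := (derivable_mxP _ _ _).1 gu i j.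
  by apply: DeriveDef => //; rewrite (derive_mx gu) mxE.
have cc (g : V -> 'M[R]_(m, n)) : smooth_near x g ->
    {for x, continuous (fun z => g z i j : R^o)}.
  move=> /smooth_near_differentiable/nbhs_singleton/differentiable_continuous gc.
  exact: (@continuous_comp _ _ _ g (fun M : 'M[R]_(m, n) => M i j) x gc
    (@coord_continuous R m n i j (g x))).
have sv := smooth_near_derive v sf; have sw := smooth_near_derive w sf.
apply: (@derive_derive_comm_real (fun z => f z i j) (fun z => 'D_v f z i j)
   (fun z => 'D_w f z i j) (fun z => 'D_w ('D_v f) z i j)
   (fun z => 'D_v ('D_w f) z i j) x v w).
- by apply: filterS (smooth_near_differentiable sf) => y /coordD.
- by apply: filterS (smooth_near_differentiable sf) => y /coordD.
- by apply: filterS (smooth_near_differentiable sv) => y /coordD.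
- by apply: filterS (smooth_near_differentiable sw) => y /coordD.
- exact/cc/smooth_near_derive.
- exact/cc/smooth_near_derive.
Qed.

End Schwarz.

(** * Tangent vectors to level sets *)

(* The curve realizing v needs a velocity at 0 only, so it is enough to choose,
   for each tau separately, a zero of f on the line e + tau v + R w that is
   almost as close as possible to e + tau v. The intermediate value theorem
   provides zeros at distance o(tau); no implicit function is needed. *)
Section LevelSetCurve.
Context (R : realType) (V : normedModType R).
Variables (T : set V) (f : V -> R^o) (e v w : V).
Hypothesis Te : T e.
Hypothesis Tf : \forall z \near e, T z <-> f z = 0.
Hypothesis fc : \forall z \near e, {for z, continuous f}.
Hypothesis fd : differentiable f e.
Hypothesis fv : 'd f e v = 0.
Hypothesis fw : 'd f e w = 1.

Lemma level_set_near_tangent (eps : R) : 0 < eps ->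
  \forall tau \near (0 : R), exists2 y : R, `|y| <= eps * `|tau| &
    T (e + tau *: v + y *: w).
Proof.
move=> eps0.
have fe : f e = 0 by apply/(nbhs_singleton Tf).
(* For [y] of size at most [eps * |tau|], the displacement [tau *: v + y *: w] has norm at most
   [|tau| * N], so a relative error [eps / N] of [f] becomes an absolute error [eps * |tau|]. *)
pose N := `|v| + eps * `|w| + 1.
have N0 : 0 < N by rewrite ltr_wpDl // addr_ge0 // mulr_ge0 // ltW.
have eN0 : 0 < eps / N by rewrite divr_gt0.
have fo : \forall z \near e, `|f z - 'd f e (z - e)| <= eps / N * `|z - e|.
  move/diff_locally : (fd) => /eqaddoP/(_ _ eN0) fo.
  rewrite (near_shift 0 e) subr0; apply: filterS fo => z.
  by rewrite !fctE /= fe add0r addrK.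
have [r /= r0 Hr] : exists2 r : R, 0 < r & forall z, `|e - z| < r ->
    [/\ T z <-> f z = 0, {for z, continuous f} &
      `|f z - 'd f e (z - e)| <= eps / N * `|z - e|].
  have : \forall z \near e, [/\ T z <-> f z = 0, {for z, continuous f} &
      `|f z - 'd f e (z - e)| <= eps / N * `|z - e|].
    by near=> z; split; near: z.
  by move=> /nbhs_normP[r /= r0 Hr]; exists r.
have : \forall tau \near (0 : R), `|tau| < r / N.
  by apply: nbhs0_lt; rewrite divr_gt0.
apply: filterS => tau taur.
pose b := eps * `|tau|.
have b0 : 0 <= b by rewrite mulr_ge0 // ltW.
have hN y : -b <= y <= b -> `|tau *: v + y *: w| <= `|tau| * N.
  rewrite -ler_norml => yb; rewrite (le_trans (ler_normD _ _)) // !normrZ.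
  rewrite /N mulrDr mulr1 ler_wpDr // mulrDr lerD2l mulrCA mulrA.
  by rewrite ler_wpM2r.
have nr y : -b <= y <= b -> `|e - (e + tau *: v + y *: w)| < r.
  move=> yb; rewrite -(addrA e) opprD addrA subrr sub0r normrN.
  by apply: le_lt_trans (hN _ yb) _; rewrite -ltr_pdivlMr.
pose F y : R := f (e + tau *: v + y *: w).
(* The differential of [f] sends [tau *: v + y *: w] to [y]. Hence [F] is nonpositive at [-b] and
   nonnegative at [b], as the intermediate value theorem requires. *)
have FE y : -b <= y <= b -> `|F y - y| <= b.
  move=> yb; have [_ _] := Hr _ (nr _ yb).
  have -> : e + tau *: v + y *: w - e = tau *: v + y *: w.
    by rewrite -(addrA e) (addrC e) addrK.
  rewrite linearD !linearZ /= fv fw scaler0 add0r [y *: 1]mulr1.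
  move=> /le_trans; apply; apply: le_trans (ler_wpM2l (ltW eN0) (hN _ yb)) _.
  by rewrite [_ * N]mulrC mulrA divfK ?lt0r_neq0.
have bb : -b <= b by rewrite ge0_cp.
have [||y yb Fy] := @IVT R F (-b) b 0 bb.
- apply: continuous_in_subspaceT => y; rewrite inE /= in_itv /= => yb.
  apply: (@continuous_comp _ _ _ (fun y : R => e + tau *: v + y *: w) f).
    by apply: cvgD; [exact: cvg_cst|apply: cvgZr_tmp; exact: cvg_id].
  by have [_] := Hr _ (nr _ yb).
- have := FE (-b); have := FE b; rewrite !lexx bb /= => /(_ isT) h1 /(_ isT) h2.
  have Fb : 0 <= F b by move: h1; rewrite ler_norml => /andP[h _]; move: h; lra.
  have Fb' : F (-b) <= 0 by move: h2; rewrite ler_norml => /andP[_ h]; move: h; lra.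
  by rewrite ge_min le_max Fb Fb' orbT.
move: yb; rewrite in_itv /= => yb; exists y; first by rewrite ler_norml.
by have [TE _ _] := Hr _ (nr _ yb); apply/TE.
Unshelve. all: by end_near. Qed.

(** The least distance need not be attained, whence the slack [tau ^+ 2]: it is negligible against
    [tau], and it vanishes at 0, which forces the selected point there to be [e]. *)
Lemma level_set_selection (tau : R) : exists z : V, T z /\
  forall y', T (e + tau *: v + y' *: w) ->
    exists2 y, z = e + tau *: v + y *: w & `|y| <= `|y'| + tau ^+ 2.
Proof.
have [[y0 Ty0]|none] := pselect (exists y, T (e + tau *: v + y *: w)); last first.
  (* A line that misses [T] gets the default value [e]; this does not happen for [tau] close to
     0. *)
  by exists e; split => // y' Ty'; exfalso; apply: none; exists y'.
have [->|tau0] := eqVneq tau 0.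
  exists e; split => // y' _; exists 0; first by rewrite !scale0r !addr0.
  by rewrite normr0 addr_ge0 // sqr_ge0.
pose S := [set `|y| | y in [set y | T (e + tau *: v + y *: w)]].
have Sinf : has_inf S.
  by split; [exists `|y0|; exists y0|exists 0 => _ [y _ <-]].
have t2 : 0 < tau ^+ 2 by rewrite exprn_even_gt0.
have [_ [y Ty <-] yS] := inf_adherent t2 Sinf.
exists (e + tau *: v + y *: w); split => // y' Ty'; exists y => //.
apply: le_trans (ltW yS) _; rewrite lerD2r.
by apply: ge_inf; [exact: Sinf.2|exists y'].
Qed.

Lemma level_set_curve : exists z : R -> V,
  [/\ z 0 = e, forall tau, T (z tau), {for 0, continuous z}
    & derivative_within setT z 0 v].
Proof.
have [z Hz] := choice level_set_selection.
have zT tau : T (z tau) by have [] := Hz tau.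
have z0 : z 0 = e.
  have [_ /(_ 0)] := Hz 0; rewrite !scale0r !addr0 => /(_ Te)[y].
  rewrite normr0 expr0n add0r normr_le0 => zE /eqP y0.
  by rewrite zE y0 scale0r addr0.
have zd : derivative_within setT z 0 v.
  rewrite /derivative_within withinET; apply/cvgrPdist_le => eta eta0.
  (* The half absorbs the slack: once [|tau| <= eps], the sum [eps * |tau| + tau ^+ 2] is at most
     [2 * eps * |tau|]. *)
  pose eps := eta / (`|w| + 1) / 2.
  have w0 : 0 < `|w| + 1 by rewrite ltr_wpDl.
  have eps0 : 0 < eps by rewrite !divr_gt0.
  have near1 : \forall tau \near (0 : R)^', exists2 y : R,
      `|y| <= eps * `|tau| & T (e + tau *: v + y *: w).
    by apply: cvg_within; exact: level_set_near_tangent.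
  have near2 : \forall tau \near (0 : R)^', `|tau| <= eps.
    exact: dnbhs0_le.
  have near3 : \forall tau \near (0 : R)^', tau != 0 by exact: withinT.
  near=> tau.
  have tau0 : tau != 0 by near: tau.
  have [y' y'b Ty'] : exists2 y : R,
    `|y| <= eps * `|tau| & T (e + tau *: v + y *: w) by near: tau.
  have [_ /(_ _ Ty')[y zE yb]] := Hz tau.
  rewrite z0 subr0 zE -(addrA e) (addrC e) addrK scalerDr scalerA mulVf //.
  rewrite scale1r opprD addrA subrr sub0r normrN scalerA normrZ normrM normfV.
  have te : `|tau| <= eps by near: tau.
  have tn : 0 < `|tau| by rewrite normr_gt0.
  have yle : `|y| <= 2 * eps * `|tau|.
    apply: (le_trans yb); rewrite -[tau ^+ 2]real_normK ?num_real // expr2.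
    by rewrite -mulrA mulr_natl mulr2n lerD // ler_wpM2r.
  apply: le_trans (_ : 2 * eps * `|w| <= eta).
    by rewrite ler_wpM2r // mulrC ler_pdivrMr.
  have -> : 2 * eps = eta / (`|w| + 1) by rewrite /eps mulrC divfK // pnatr_eq0.
  by rewrite mulrAC ler_pdivrMr // ler_wpM2l ?ltW // ltrDl.
exists z; split => //.
apply/continuous_withinNx; have := derivative_within_cvg zd.
by rewrite withinET.
Unshelve. all: by end_near. Qed.

End LevelSetCurve.

(** * Manifolds *)

Section Charts.
Context (R : realType) (n : nat) (M : manifoldType R n).

Lemma chart_atK (x y : M) :
  cdom (chart_at x) y -> cinv (chart_at x) (chart_at x y) = y.
Proof. exact: cmapK. Qed.

Lemma chart_at_idK (x : M) : cinv (chart_at x) (chart_at x x) = x.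
Proof. exact/chart_atK/mem_chart_at. Qed.

Lemma near_chart_at (x y : M) : cdom (chart_at x) y ->
  \forall z \near y, cdom (chart_at x) z.
Proof. by move=> xy; apply: open_nbhs_nbhs; split => //; exact: cdom_open. Qed.

Lemma near_chart_at_id (x : M) : \forall z \near x, cdom (chart_at x) z.
Proof. exact/near_chart_at/mem_chart_at. Qed.

Lemma near_cinv (x y : M) (P : set M) : cdom (chart_at x) y ->
  (\forall z \near y, P z) ->
  \forall u \near chart_at x y, P (cinv (chart_at x) u).
Proof.
move=> xy Py.
have : cinv (chart_at x) @ chart_at x y --> cinv (chart_at x) (chart_at x y).
  exact: cinv_continuous.
by rewrite chart_atK //; apply.
Qed.

Lemma near_cmap (x y : M) (P : set 'rV[R]_n) : cdom (chart_at x) y ->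
  (\forall u \near chart_at x y, P u) -> \forall z \near y, P (chart_at x z).
Proof. by move=> xy Py; exact: (@cmap_continuous _ _ _ (chart_at x) y xy). Qed.

Lemma near_chart_at_cinvK (x y : M) : cdom (chart_at x) y ->
  \forall u \near chart_at x y, chart_at x (cinv (chart_at x) u) = u.
Proof.
move=> xy.
have : \forall u \near chart_at x y, (chart_at x @` cdom (chart_at x)) u.
  by apply: open_nbhs_nbhs; split; [exact: cimg_open|exists y].
by apply: filterS => _ [z xz <-]; rewrite chart_atK.
Qed.

Lemma differentiable_chart_change (x y z : M) :
  cdom (chart_at x) z -> cdom (chart_at y) z ->
  differentiable (chart_at y \o cinv (chart_at x)) (chart_at x z).
Proof.
by move=> xz yz; have [d _] := chart_compat x y 1; apply: d; exists z.
Qed.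

Lemma transitionK (x y z : M) : cdom (chart_at x) z -> cdom (chart_at y) z ->
  transition x y z *m transition y x z = 1%:M.
Proof.
move=> xz yz; rewrite /transition.
set f := chart_at y \o cinv (chart_at x).
set g := chart_at x \o cinv (chart_at y).
have fz : chart_at y z = f (chart_at x z) by rewrite /f /= chart_atK.
have fd : differentiable f (chart_at x z) by exact: differentiable_chart_change.
have gd : differentiable g (f (chart_at x z)).
  by rewrite -fz; exact: differentiable_chart_change.
rewrite fz; apply: etrans (esym (jacobian_comp fd gd)) _.
apply: etrans _ (jacobian_id (chart_at x z)).
apply: near_eq_jacobian; last by have [] := is_diff_id (chart_at x z).
near=> u; rewrite /f /g /= chart_atK.
  by apply/esym; near: u; exact: near_chart_at_cinvK.
by near: u; apply: near_cinv => //; exact: near_chart_at.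
Unshelve. all: by end_near. Qed.

Lemma transition_id (x y : M) : cdom (chart_at x) y -> transition x x y = 1%:M.
Proof.
move=> xy; apply: etrans _ (jacobian_id (chart_at x y)).
apply: near_eq_jacobian; last by have [] := is_diff_id (chart_at x y).
by apply: filterS (near_chart_at_cinvK xy) => u /= ->.
Qed.

Lemma diff_dfun (f : M -> R) (x : M) (v : 'rV[R]_n) :
  'd (f \o cinv (chart_at x) : 'rV[R]_n -> R^o) (chart_at x x) v =
  pairing (dfun f x) v.
Proof.
rewrite {1}[v]row_sum_delta linear_sum /pairing mxE; apply: eq_bigr => i _.
by rewrite linearZ mxE.
Qed.

End Charts.

(** * Differentials of maps between manifolds and velocities of image curves *)

Section MapsBetweenManifolds.
Context (R : realType) (l m n : nat) (L : manifoldType R l)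
  (M : manifoldType R m) (N : manifoldType R n).

(** [tangent] refers to the preferred chart at [f x]. Any other chart around [f x] serves as well,
    at the price of a change of coordinates composed on the target side. *)
Lemma tangent_chart (f : L -> M) (x : L) (w : M) :
  let phi := chart_at w \o f \o cinv (chart_at x) in
  {for x, continuous f} -> cdom (chart_at w) (f x) ->
  differentiable phi (chart_at x x) ->
  differentiable (local_rep f x) (chart_at x x) /\
  tangent f x = jacobian phi (chart_at x x) *m transition w (f x) (f x).
Proof.
move=> phi fc wfx phid; set c := chart_at (f x) \o cinv (chart_at w).
have phix : phi (chart_at x x) = chart_at w (f x) by rewrite /phi /= chart_at_idK.
have cd : differentiable c (phi (chart_at x x)).
  by rewrite phix; apply: differentiable_chart_change => //; exact: mem_chart_at.
have E : {near chart_at x x, c \o phi =1 local_rep f x}.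
  near=> u; rewrite /c /phi /local_rep /= chart_atK //.
  near: u; apply: (near_cinv (P := fun z => cdom (chart_at w) (f z))
    (mem_chart_at x)).
  exact: (fc _ (near_chart_at wfx)).
have cpd := differentiable_comp phid cd.
split; first exact: near_eq_differentiable E cpd.
apply: etrans (near_eq_jacobian E cpd) _; apply: etrans (jacobian_comp phid cd) _.
by rewrite phix.
Unshelve. all: by end_near. Qed.

Lemma tangent_comp (f : L -> M) (g : M -> N) (x : L) :
  {for x, continuous f} ->
  differentiable (local_rep f x) (chart_at x x) ->
  differentiable (local_rep g (f x)) (chart_at (f x) (f x)) ->
  tangent (g \o f) x = tangent f x *m tangent g (f x).
Proof.
move=> fc fd gd.
have fx : local_rep f x (chart_at x x) = chart_at (f x) (f x).
  by rewrite /local_rep /= chart_at_idK.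
rewrite -fx in gd; apply: etrans.
  apply: near_eq_jacobian _ (differentiable_comp fd gd).
  near=> u; rewrite /local_rep /= chart_atK //.
  near: u; apply: (near_cinv (P := fun z => cdom (chart_at (f x)) (f z))
    (mem_chart_at x)).
  exact: (fc _ (near_chart_at_id (f x))).
by apply: etrans (jacobian_comp fd gd) _; rewrite fx.
Unshelve. all: by end_near. Qed.

Lemma velocity_within_comp (I : set R) (c : R -> L) (t : R) (v : 'rV[R]_l)
    (f : L -> M) :
  {for c t, continuous f} ->
  differentiable (local_rep f (c t)) (chart_at (c t) (c t)) ->
  velocity_within I c t v ->
  velocity_within I (f \o c) t (tangent_map f (c t) v).
Proof.
move=> fc fd [cc cv]; split; first exact: cvg_comp cc fc.
have := derivative_within_comp fd cv.
have -> : 'd (local_rep f (c t)) (chart_at (c t) (c t)) v = tangent_map f (c t) v.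
  by rewrite -(deriveE _ fd) (deriveEjacobian _ fd).
apply: derivative_within_near_eq; last by rewrite /local_rep /= chart_at_idK.
have : \forall s \near within I (nbhs t), cdom (chart_at (c t)) (c s).
  exact: (cc _ (near_chart_at_id (c t))).
move=> H; have : \forall s \near within I t^', cdom (chart_at (c t)) (c s).
  by move: H; rewrite /within /=; exact: nbhs_dnbhs.
by apply: (@filterS _ (within I t^')) => s cs; rewrite /local_rep /= chart_atK.
Qed.

End MapsBetweenManifolds.

(** * Differentiability of Jacobians and symmetry of their derivatives *)

Section SmoothJacobian.
Context (R : realType).

Lemma smooth_on_pairr (U V W : normedModType R) (A : set (U * V))
    (f : U * V -> W) (u : U) :
  smooth_on A f -> smooth_on [set v | A (u, v)] (fun v => f (u, v)).
Proof.
move=> sf k; move: f {sf}(sf k); elim: k => [|k IH] f /=.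
  move=> fc v Av; apply: (@continuous_comp _ _ _ (fun v' => (u, v')) f).
    exact/differentiable_continuous/differentiable_pair2.
  exact: fc.
move=> [fd fD]; split=> [v Av|w].
  apply: (@differentiable_comp _ _ _ _ (fun v' => (u, v')) f).
    exact: differentiable_pair2.
  exact: fd.
have -> : (fun x => 'D_w (fun v => f (u, v)) x) = (fun x => 'D_(0, w) f (u, x)).
  by apply/funext => v; exact: derive_pairr.
exact: (IH ('D_((0 : U), w) f) (fD (0, w))).
Qed.

Lemma smooth_near_pairr (U V W : normedModType R) (f : U * V -> W) (u : U)
    (v : V) :
  smooth_near (u, v) f -> smooth_near v (fun v' => f (u, v')).
Proof.
move=> [A [Ao Auv sf]]; exists [set v | A (u, v)]; split => //; last first.
  exact: smooth_on_pairr.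
apply: (@open_comp _ _ (fun v' => (u, v'))) => // v' _.
by apply: cvg_pair; [exact: cvg_cst|exact: cvg_id].
Qed.

Lemma differentiable_mx_row (V : normedModType R) (m n : nat)
    (A : V -> 'M[R]_(m, n)) (B : 'I_m -> V -> 'rV[R]_n) (x : V) :
  (forall i, \forall y \near x, row i (A y) = B i y) ->
  (forall i, differentiable (B i) x) -> differentiable A x.
Proof.
move=> AB Bd; apply: differentiable_mx => i j.
have E : {near x, (fun y => B i y 0 j) =1 (fun y => A y i j)}.
  by apply: filterS (AB i) => y <-; rewrite mxE.
apply: near_eq_differentiable E _.
apply: (@differentiable_comp _ _ _ _ (B i) (fun M : 'rV[R]_n => M 0 j : R^o)) => //.
exact: differentiable_coord.
Qed.

Lemma derive_mulmxl (V : normedModType R) (m n : nat) (A : V -> 'M[R]_(m, n))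
    (x xi : V) (eta : 'rV[R]_m) : differentiable A x ->
  'D_xi (fun y => eta *m A y) x = eta *m 'd A x xi.
Proof.
move=> /differentiableP Ad.
have [d E] := is_diff_mulmx (is_diff_cst eta x) Ad.
by rewrite (deriveE _ d) E /= mul0mx addr0.
Qed.

Lemma differentiable_jacobian (m n : nat) (f : 'rV[R]_m -> 'rV[R]_n)
    (x : 'rV[R]_m) : smooth_near x f -> differentiable (jacobian f) x.
Proof.
move=> sf; apply: (differentiable_mx_row (B := fun i => 'D_(delta_mx 0 i) f)) => i.
  by apply: filterS (smooth_near_differentiable sf) => y /row_jacobian ->.
exact: nbhs_singleton (smooth_near_differentiable (smooth_near_derive _ sf)).
Qed.

(** The rows of the partial Jacobian are derivatives of [f] along the vectors [(0, delta_mx 0 i)],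
    which are again smooth in both variables. *)
Lemma differentiable_jacobianr (U : normedModType R) (m n : nat)
    (f : U * 'rV[R]_m -> 'rV[R]_n) (u : U) (x : 'rV[R]_m) :
  smooth_near (u, x) f ->
  differentiable (fun u' => jacobian (fun x' => f (u', x')) x) u.
Proof.
move=> sf; apply: (differentiable_mx_row
   (B := fun i u' => 'D_(0, delta_mx 0 i) f (u', x))) => i.
  have cx := @cvg_pairl _ _ u x.
  have : \forall u' \near u, differentiable f (u', x).
    exact: (cx _ (smooth_near_differentiable sf)).
  apply: filterS => u' fd; rewrite -derive_pairr; apply: row_jacobian.
  exact: (@differentiable_comp _ _ _ _ (fun x' => (u', x')) f x
    (differentiable_pair2 u' x) fd).
apply: (@differentiable_comp _ _ _ _ (fun u' => (u', x)) ('D_(0, delta_mx 0 i) f)).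
  exact: differentiable_pair1.
exact: nbhs_singleton (smooth_near_differentiable (smooth_near_derive _ sf)).
Qed.

(** Both sides are iterated directional derivatives of [f], so this is the symmetry of second
    derivatives in the form in which it cancels terms of the Lie bracket. *)
Lemma diff_jacobian_sym (m n : nat) (f : 'rV[R]_m -> 'rV[R]_n)
    (x xi eta : 'rV[R]_m) : smooth_near x f ->
  eta *m 'd (jacobian f) x xi = xi *m 'd (jacobian f) x eta.
Proof.
move=> sf; have Jd := differentiable_jacobian sf.
have E (a b : 'rV[R]_m) : a *m 'd (jacobian f) x b = 'D_b ('D_a f) x.
  rewrite -(derive_mulmxl _ _ Jd); apply: near_eq_derive.
  by apply: filterS (smooth_near_differentiable sf) => y /deriveEjacobian ->.
exact: etrans (E _ _) (etrans (derive_derive_comm _ _ sf) (esym (E _ _))).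
Qed.

End SmoothJacobian.

Lemma mulmx_cancelr (R : realType) (l m n : nat) (b : 'M[R]_(l, m))
    (A : 'M[R]_(m, n)) (T T' : 'M[R]_n) :
  T *m T' = 1%:M -> b *m (A *m T) *m T' = b *m A.
Proof. by move=> TT'; rewrite -!mulmxA TT' mulmx1. Qed.

(** * Lie groups *)

Section LieGroup.
Context (R : realType) (n : nat) (G : lieGroupType R n).
Implicit Types (g x y : G) (u v : 'rV[R]_n).

Local Notation one := (1%g : G).
Local Notation e := (chart_at one one).

Lemma ltrans_continuous g : continuous (ltrans g).
Proof.
move=> x; apply: (@continuous_comp _ _ _ (fun y => (g, y))
  (fun z : G * G => (z.1 * z.2)%g)).
  by apply: cvg_pair; [exact: cvg_cst|exact: cvg_id].
exact: lie_mul_continuous.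
Qed.

(** Products of elements near [g] with elements near 1 lie near [g], so the chart at [g] serves for
    both the first factor and the product. *)
Definition chart_mul g (w : 'rV[R]_n * 'rV[R]_n) : 'rV[R]_n :=
  chart_at g (cinv (chart_at g) w.1 * cinv (chart_at one) w.2)%g.

(* The differential of left translation by [y = cinv (chart_at g) u] at 1, from
   [chart_at 1] to the fixed chart [chart_at g] instead of [chart_at y]. *)
Definition trivialization g u : 'M[R]_n :=
  jacobian (fun v => chart_mul g (u, v)) e.

Lemma chart_mul_smooth g : smooth_near (chart_at g g, e) (chart_mul g).
Proof. by have := lie_mul_smooth g one; rewrite mulg1. Qed.

Lemma trivialization_differentiable g :
  differentiable (trivialization g) (chart_at g g).
Proof. exact/differentiable_jacobianr/chart_mul_smooth. Qed.

(** The preferred chart at [y] need not vary continuously with [y]. Splitting off the transition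
    isolates this dependence and leaves a factor differentiable in [y]. *)
Lemma tangent_ltrans g : \forall y \near g,
  tangent (ltrans y) one =
  trivialization g (chart_at g y) *m transition g y y.
Proof.
have sm := smooth_near_differentiable (chart_mul_smooth g).
have cg : (fun y => (chart_at g y, e)) @ g --> (chart_at g g, e).
  exact: (cvg_comp _ _ (cmap_continuous (mem_chart_at g))
    (@cvg_pairl _ _ (chart_at g g) e)).
near=> y; have gy : cdom (chart_at g) y by near: y; exact: near_chart_at_id.
have yd : differentiable (chart_mul g) (chart_at g y, e).
  by near: y; exact: cg _ sm.
have E : chart_at g \o ltrans y \o cinv (chart_at one) =
    (fun v => chart_mul g (chart_at g y, v)).
  by apply/funext => v; rewrite /chart_mul /= chart_atK.
have phid : differentiable (chart_at g \o ltrans y \o cinv (chart_at one)) e.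
  rewrite E; exact: (@differentiable_comp _ _ _ _ (fun v => (chart_at g y, v))
    (chart_mul g) e (differentiable_pair2 _ _) yd).
have y1 : ltrans y one = y by rewrite /ltrans mulg1.
have wy : cdom (chart_at g) (ltrans y one) by rewrite y1.
have [_ ->] := tangent_chart (@ltrans_continuous y one) wy phid.
by rewrite E y1.
Unshelve. all: by end_near. Qed.

Lemma ltrans_local_rep g : local_rep (ltrans g) one =
  (fun v => chart_mul g (chart_at g g, v)).
Proof.
apply/funext => v.
by rewrite /local_rep /chart_mul /= {1}/ltrans mulg1 chart_at_idK.
Qed.

Lemma ltrans_local_rep1 g : local_rep (ltrans g) one e = chart_at g g.
Proof. by rewrite ltrans_local_rep /chart_mul /= !chart_at_idK mulg1. Qed.

Lemma ltrans_smooth g : smooth_near e (local_rep (ltrans g) one).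
Proof. by rewrite ltrans_local_rep; exact/smooth_near_pairr/chart_mul_smooth. Qed.

Lemma ltrans_differentiable g : differentiable (local_rep (ltrans g) one) e.
Proof. exact: nbhs_singleton (smooth_near_differentiable (ltrans_smooth g)). Qed.

Lemma trivialization_chart g :
  trivialization g (chart_at g g) = tangent (ltrans g) one.
Proof. by rewrite /tangent ltrans_local_rep. Qed.

Lemma tangent_ltrans1 : tangent (ltrans one) one = 1%:M.
Proof.
apply: etrans _ (jacobian_id e).
apply: near_eq_jacobian; last by have [] := is_diff_id e.
have := near_chart_at_cinvK (mem_chart_at one).
by apply: filterS => v; rewrite /local_rep /ltrans /= !mul1g.
Qed.

(** This is the chain rule for the translation by [g y] as the translation by [y] followed by the
    one by [g], where [u] is the coordinate of [y]. *)
Lemma trivialization_ltrans g : \forall u \near e,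
  trivialization g (local_rep (ltrans g) one u) =
  trivialization one u *m jacobian (local_rep (ltrans g) one) u.
Proof.
have sm := smooth_near_differentiable (chart_mul_smooth one).
have cu := @cvg_pairl _ _ e e.
have sg := smooth_near_differentiable (ltrans_smooth g).
near=> u.
have ud : differentiable (fun v => chart_mul one (u, v)) e.
  have d1 : differentiable (chart_mul one) (u, e) by near: u; exact: cu _ sm.
  exact: (@differentiable_comp _ _ _ _ (fun v => (u, v)) (chart_mul one) e
    (differentiable_pair2 _ _) d1).
have u1 : cdom (chart_at one) (cinv (chart_at one) u).
  by near: u; apply: (near_cinv (mem_chart_at one)); exact: near_chart_at_id.
have ue : chart_mul one (u, e) = u.
  rewrite /chart_mul /= chart_at_idK mulg1.
  by near: u; exact: near_chart_at_cinvK (mem_chart_at one).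
have gu : cdom (chart_at g) (g * cinv (chart_at one) u)%g.
  near: u; apply: (near_cinv (P := fun y => cdom (chart_at g) (g * y)%g)
    (mem_chart_at one)).
  apply: (ltrans_continuous (g := g) (x := one)).
  by rewrite /ltrans mulg1; exact: near_chart_at_id.
have dg : differentiable (local_rep (ltrans g) one) (chart_mul one (u, e)).
  by rewrite ue; near: u.
rewrite /trivialization -[X in _ *m jacobian _ X]ue.
apply: etrans _ (jacobian_comp ud dg).
apply: near_eq_jacobian _ (differentiable_comp ud dg).
near=> v; rewrite ltrans_local_rep /chart_mul /= chart_at_idK.
rewrite chart_atK; last first.
  near: v; apply: (near_cinv
    (P := fun y => cdom (chart_at one) (cinv (chart_at one) u * y)%g)
    (mem_chart_at one)).
  apply: (ltrans_continuous (x := one)).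
  by rewrite /ltrans mulg1; exact: near_chart_at.
by rewrite chart_atK // mulgA.
Unshelve. all: by end_near. Qed.

(** In the fixed chart at 1 the transitions cancel, so the left-invariant field of [b] reads
    [b *m trivialization one u], and its derivative along [a] is [b] times that of the matrix. *)
Lemma lie_bracket_trivialization1 (xi eta : 'rV[R]_n) :
  lie_bracket G xi eta = eta *m 'd (trivialization one) e xi
                       - xi *m 'd (trivialization one) e eta.
Proof.
have L (a b : 'rV[R]_n) :
    'D_(left_field a one) (field_in_chart (left_field b) one) e =
    b *m 'd (trivialization one) e a.
  have -> : left_field a one = a.
    by rewrite /left_field /tangent_map tangent_ltrans1 mulmx1.
  rewrite -(derive_mulmxl _ _ (trivialization_differentiable one)).
  apply: near_eq_derive.
  near=> u; have u1 : cdom (chart_at one) (cinv (chart_at one) u).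
    by near: u; apply: (near_cinv (mem_chart_at one)); exact: near_chart_at_id.
  have uK : chart_at one (cinv (chart_at one) u) = u.
    by near: u; exact: near_chart_at_cinvK (mem_chart_at one).
  rewrite /field_in_chart /left_field /tangent_map.
  have -> : tangent (ltrans (cinv (chart_at one) u)) one =
      trivialization one u *m
      transition one (cinv (chart_at one) u) (cinv (chart_at one) u).
    rewrite -[X in trivialization _ X]uK.
    near: u; exact: (near_cinv (mem_chart_at one) (tangent_ltrans one)).
  exact: (mulmx_cancelr _ _ (transitionK u1 (mem_chart_at _))).
by rewrite /lie_bracket /field_bracket !L.
Unshelve. all: by end_near. Qed.

Lemma lie_bracket_trivialization g (xi eta : 'rV[R]_n) :
  let A := trivialization g (chart_at g g) in
  lie_bracket G xi eta *m A =
  eta *m 'd (trivialization g) (chart_at g g) (xi *m A)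
  - xi *m 'd (trivialization g) (chart_at g g) (eta *m A).
Proof.
move=> A; set phi := local_rep (ltrans g) one.
have phid : differentiable phi e := ltrans_differentiable g.
have phi_e : phi e = chart_at g g := ltrans_local_rep1 g.
have phiA : jacobian phi e = A by rewrite /A trivialization_chart.
have Ad := trivialization_differentiable g.
have A1d := trivialization_differentiable one.
have Jd := differentiable_jacobian (ltrans_smooth g).
have AE : trivialization one e = 1%:M.
  by rewrite trivialization_chart tangent_ltrans1.
(* Both sides of [trivialization_ltrans] are differentiated at the identity: the chain rule on the
   left, the product rule on the right. *)
have D a : 'd (trivialization g) (chart_at g g) (a *m A) =
    'd (jacobian phi) e a + 'd (trivialization one) e a *m A.
  have dL : is_diff e (trivialization g \o phi)
      ('d (trivialization g) (chart_at g g) \o 'd phi e).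
    rewrite -phi_e in Ad *.
    exact: is_diff_comp (differentiableP phid) (differentiableP Ad).
  have dR := is_diff_mulmx (differentiableP A1d) (differentiableP Jd).
  have [dr Er] := near_eq_is_diff (trivialization_ltrans g) dL.
  have [_ Er'] := dR.
  have := congr1 (fun F => F a) (etrans (esym Er) Er') => /=.
  rewrite AE mul1mx phiA => <-; congr ('d _ _ _).
  by rewrite -phiA -(deriveEjacobian _ phid) (deriveE _ phid).
have bracketE (br : 'rV[R]_n) (Tx Te Jx Je Dx De B : 'M[R]_n) :
    br = eta *m Tx - xi *m Te -> Dx = Jx + Tx *m B -> De = Je + Te *m B ->
    eta *m Jx = xi *m Je -> br *m B = eta *m Dx - xi *m De.
  move=> -> -> -> JE; rewrite mulmxBl !mulmxDr !mulmxA JE opprD addrACA subrr.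
  by rewrite add0r.
exact: bracketE (lie_bracket_trivialization1 xi eta) (D xi) (D eta)
  (diff_jacobian_sym xi eta (ltrans_smooth g)).
Qed.

End LieGroup.

(** * Momentum equations *)

Section NaturalHamiltonian.
Context (R : realType) (n : nat) (M : manifoldType R n).
Variables (m : M -> 'M[R]_n) (V : M -> R) (H : M -> 'cV[R]_n -> R).
Hypothesis Hnat : natural_hamiltonian m V H.

Lemma metric_sym x : (m x)^T = m x.
Proof.
have [[msym _] _] := Hnat; apply/matrixP => i j; rewrite mxE.
have E k l : metric m x (delta_mx 0 k) (delta_mx 0 l) = m x k l.
  by rewrite /metric -rowE trmx_delta -colE !mxE.
by rewrite -!E msym.
Qed.

Lemma cometric_sym x p r : cometric m x p r = cometric m x r p.
Proof.
have -> : cometric m x p r = (p^T *m invmx (m x) *m r)^T 0 0 by rewrite mxE.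
by rewrite !trmx_mul trmxK trmx_inv metric_sym mulmxA.
Qed.

Lemma is_diff_natural_hamiltonian x p :
  is_diff p (H x : 'cV[R]_n -> R^o) (cometric m x p).
Proof.
have HE : H x = (fun r => 2^-1 *: (cometric m x r r : R^o) + cst (V x) r)
    :> ('cV[R]_n -> R^o).
  by apply/funext => r; have [_ ->] := Hnat.
have q1 := is_diff_mulmx (is_diff_trmx p) (is_diff_cst (invmx (m x)) p).
have q2 := is_diff_mulmx q1 (is_diff_id p).
have q3 := is_diff_comp q2 (is_diff_coord _ 0 0).
have q4 := is_diffD (is_diffZ 2^-1 q3) (is_diff_cst (V x : R^o) p).
rewrite HE; apply: is_diff_eq q4 _; apply/funext => v.
rewrite !fctE /= mulmx0 add0r mxE addr0 -/(cometric m x p v) -/(cometric m x v p).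
rewrite (cometric_sym x v) -[LHS]/(2^-1 * (cometric m x p v + cometric m x p v)).
lra.
Qed.

(** The Legendre transform of a natural Hamiltonian is the musical isomorphism; hence the vector
    driving the momentum is also the one driving the position. *)
Lemma codifferentialE x p : codifferential (H x) p = sharp m x p.
Proof.
have [d E] := is_diff_natural_hamiltonian x p.
by apply/rowP => i; rewrite mxE E /cometric -colE mxE.
Qed.

End NaturalHamiltonian.

Section Momentum.
Context (R : realType) (n : nat) (G : lieGroupType R n).

Local Notation one := (1%g : G).
Local Notation zeta z := (pullback (ltrans z.1) one z.2).

Definition chart_momentum (g : G) (w : 'rV[R]_n * 'cV[R]_n) : 'cV[R]_n :=
  trivialization g w.1 *m w.2.

(** The transition split off in [tangent_ltrans] is the one by which [ct_chart] transports
    covectors. *)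
Lemma near_chart_momentum (g : G) : \forall y \near g, forall p,
  zeta (y, p) = chart_momentum g (ct_chart g (y, p)).
Proof.
apply: filterS (tangent_ltrans g) => y E p.
exact: etrans (congr1 (mulmx^~ p) E) (esym (mulmxA _ _ _)).
Qed.

Lemma chart_momentum_id (g : G) p :
  zeta (g, p) = chart_momentum g (ct_chart g (g, p)).
Proof. exact: nbhs_singleton (near_chart_momentum g) p. Qed.

Lemma is_diff_chart_momentum (g : G) (p : 'cV[R]_n) :
  is_diff (ct_chart g (g, p)) (chart_momentum g)
    (fun X => tangent (ltrans g) one *m X.2
              + 'd (trivialization g) (chart_at g g) X.1 *m p).
Proof.
have tT : is_diff ((ct_chart g (g, p)).1) (trivialization g)
    ('d (trivialization g) (chart_at g g)).
  exact: differentiableP (trivialization_differentiable g).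
have d1 := is_diff_comp (is_diff_fst (ct_chart g (g, p))) tT.
have d2 := is_diff_snd (ct_chart g (g, p)).
apply: is_diff_eq (is_diff_mulmx d1 d2) _.
apply/funext => X; rewrite /= trivialization_chart.
by rewrite (transition_id (mem_chart_at g)) mul1mx.
Qed.

Lemma ct_cvg_momentum (F : set_system R) (FF : Filter F)
    (c : R -> G * 'cV[R]_n) (z : G * 'cV[R]_n) :
  ct_cvg F c z -> zeta (c s) @[s --> F] --> zeta z.
Proof.
case: z => g p [cg cz]; have /= cM := cg _ (near_chart_momentum g).
have [/differentiable_continuous Mc _] := is_diff_chart_momentum g p.
have cMc := cvg_comp _ _ cz Mc; rewrite chart_momentum_id.
apply: cvg_trans cMc; apply: near_eq_cvg.
by move: cM; apply: (@filterS _ F) => s /= ->; case: (c s).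
Qed.

Lemma ct_velocity_within_momentum (I : set R) (c : R -> G * 'cV[R]_n) (t : R)
    (X : 'rV[R]_n * 'cV[R]_n) :
  ct_velocity_within I c t X ->
  derivative_within I (fun s => zeta (c s)) t
    (tangent (ltrans (c t).1) one *m X.2
     + 'd (trivialization (c t).1) (chart_at (c t).1 (c t).1) X.1 *m (c t).2).
Proof.
move=> [cg cX].
have [Md ME] := is_diff_chart_momentum (c t).1 (c t).2.
have cE : ct_chart (c t).1 (c t) = ct_chart (c t).1 ((c t).1, (c t).2).
  by case: (c t).
rewrite -cE in Md ME; have := derivative_within_comp Md cX; rewrite ME.
apply: derivative_within_near_eq; last by rewrite cE -chart_momentum_id.
have cM : \forall s \near within I (nbhs t), forall p,
    zeta ((c s).1, p) = chart_momentum (c t).1 (ct_chart (c t).1 ((c s).1, p)).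
  exact: cg _ (near_chart_momentum (c t).1).
have : \forall s \near within I t^', forall p,
    zeta ((c s).1, p) = chart_momentum (c t).1 (ct_chart (c t).1 ((c s).1, p)).
  by move: cM; rewrite /within /=; exact: nbhs_dnbhs.
by apply: (@filterS _ (within I t^')) => s /= ->; case: (c s).
Qed.

Variables (m : G -> 'M[R]_n) (V : G -> R) (H : G -> 'cV[R]_n -> R).
Hypothesis Hnat : natural_hamiltonian m V H.
Hypothesis Hinv : left_invariant H.

(** By left-invariance the Hamiltonian in a bundle chart factors through the momentum, so
    differentiating it reduces to differentiating its restriction to the fiber over 1. *)
Lemma hamiltonian_in_chart (g : G) (p : 'cV[R]_n) :
  \forall w \near ct_chart g (g, p),
    H one (chart_momentum g w) = H (ct_chart_inv g w).1 (ct_chart_inv g w).2.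
Proof.
have c1 : fst @ ct_chart g (g, p) --> (chart_at g g : 'rV[R]_n) by exact: cvg_fst.
have k1 := c1 _ (near_chart_at_cinvK (mem_chart_at g)).
have k2 := c1 _ (near_cinv (mem_chart_at g) (near_chart_at_id g)).
have k3 := c1 _ (near_cinv (mem_chart_at g) (near_chart_momentum g)).
near=> w.
have wK : chart_at g (cinv (chart_at g) w.1) = w.1 by near: w.
have gw : cdom (chart_at g) (cinv (chart_at g) w.1) by near: w.
have E q : zeta (cinv (chart_at g) w.1, q) =
  chart_momentum g (ct_chart g (cinv (chart_at g) w.1, q)) by move: q; near: w.
rewrite [RHS]Hinv; congr (H one _); apply: etrans _ (esym (E _)).
rewrite /chart_momentum /ct_chart /ct_chart_inv /= wK; congr (_ *m _).
by rewrite mulmxA (transitionK gw (mem_chart_at _)) mul1mx.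
Unshelve. all: by end_near. Qed.

Lemma hamiltonian_vectorE (g : G) (p : 'cV[R]_n) (X : 'rV[R]_n * 'cV[R]_n) :
  hamiltonian_vector H (g, p) X ->
  X.1 = tangent_map (ltrans g) one (sharp m one (zeta (g, p))) /\
  (forall v : 'rV[R]_n, v *m X.2 =
    - (sharp m one (zeta (g, p)) *m 'd (trivialization g) (chart_at g g) v *m p)).
Proof.
set xi := sharp m one _; move=> [_ HX].
have dM := is_diff_chart_momentum g p.
have dh := is_diff_natural_hamiltonian Hnat one (zeta (g, p)).
rewrite chart_momentum_id in dh.
have [_ dE] := near_eq_is_diff (hamiltonian_in_chart g p) (is_diff_comp dM dh).
have {}HX Y : omega X Y = (xi *m (tangent (ltrans g) one *m Y.2
              + 'd (trivialization g) (chart_at g g) Y.1 *m p)) 0 0.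
  by rewrite HX /= dE /= -chart_momentum_id.
split=> [|v].
  (* Vertical test vectors give the velocity of the base point; horizontal ones, used next, give the
     derivative of the momentum coordinates. *)
  apply: row_pairing_inj => b; have := HX (0, b).
  rewrite /omega /pairing /= linear0 !mul0mx addr0 [(0 : 'M[R]_1) _ _]mxE subr0.
  by rewrite mulmxA.
have := HX (v, 0).
rewrite /omega /pairing /= !mulmx0 add0r [(0 : 'M[R]_1) _ _]mxE sub0r => E.
by apply/matrixP => i j; rewrite !ord1 [in RHS]mxE -mulmxA -E opprK.
Qed.

Lemma ad_star_momentum (g : G) (p : 'cV[R]_n) (X : 'rV[R]_n * 'cV[R]_n) :
  hamiltonian_vector H (g, p) X ->
  tangent (ltrans g) one *m X.2
    + 'd (trivialization g) (chart_at g g) X.1 *m p =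
  ad_star G (codifferential (H one) (zeta (g, p))) (zeta (g, p)).
Proof.
move=> /hamiltonian_vectorE [X1 X2].
rewrite (codifferentialE Hnat); set xi := sharp m one _ in X1 X2 *.
apply/colP => i; rewrite [RHS]mxE /pairing.
have L := lie_bracket_trivialization g xi (delta_mx 0 i).
rewrite trivialization_chart /= in L.
have aux (A Dx De : 'M[R]_n) (P Q : 'cV[R]_n) (a br : 'rV[R]_n) :
    br *m A = delta_mx 0 i *m Dx - a *m De ->
    delta_mx 0 i *m A *m Q = - (a *m De *m P) ->
    (A *m Q + Dx *m P) i 0 = (br *m (A *m P)) 0 0.
  move=> E1 E2; rewrite mulmxA E1 mulmxBl.
  by rewrite -E2 -!mulmxA -mulmxDr -rowE [RHS]mxE addrC.
(* The horizontal equation is applied to the image of the [i]-th basis vector under the left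
   translation, so that the two terms combine into the bracket. *)
rewrite X1; exact: aux L (X2 _).
Qed.

End Momentum.

(** * Impacts *)

Lemma exists_pairing1 (R : realType) (n : nat) (W : 'cV[R]_n) :
  W != 0 -> exists w : 'rV[R]_n, pairing W w = 1.
Proof.
move=> W0; have [i Wi] : exists i, W i 0 != 0.
  apply/existsP; apply: contraNT W0 => /existsPn W0.
  by apply/eqP/colP => i; rewrite mxE; apply/eqP; have := W0 i; rewrite negbK.
exists ((W i 0)^-1 *: delta_mx 0 i).
by rewrite /pairing -scalemxAl -rowE !mxE mulVf.
Qed.

(** For [w] with pairing 1, subtracting [W j 0 *: w] from the [j]-th basis vector lands in the
    kernel of [W]; the coefficient sought is the value of [d] on [w]. *)
Lemma line_of_annihilator (R : realType) (n : nat) (W d : 'cV[R]_n) : W != 0 ->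
  (forall v : 'rV[R]_n, pairing W v = 0 -> pairing d v = 0) ->
  exists c : R, d = c *: W.
Proof.
move=> /exists_pairing1[w Ww] Wd; exists (pairing d w); apply/colP => j.
have := Wd (delta_mx 0 j - W j 0 *: w).
have E (a : 'cV[R]_n) :
    pairing a (delta_mx 0 j - W j 0 *: w) = a j 0 - W j 0 * pairing a w.
  by rewrite /pairing mulmxBl -scalemxAl -rowE !mxE.
rewrite !E Ww mulr1 subrr => /(_ erefl) /eqP; rewrite subr_eq0 => /eqP ->.
by rewrite [RHS]mxE mulrC.
Qed.

(** * The annihilator of the Lie algebra of [K], seen from a point of the coset *)

Section Coset.
Context (R : realType) (n : nat) (G : lieGroupType R n).
Variables (K : set G) (g0 g : G) (s : G -> R).
Hypothesis Knormal : normal_subgroup K.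
Hypothesis Sg : right_coset K g0 g.
Hypothesis sdef : defining_function (right_coset K g0) g s.

Local Notation one := (1%g : G).
Local Notation e := (chart_at one one).
Local Notation W := (pullback (ltrans g) one (dfun s g)).
Local Notation f := (s \o ltrans g \o cinv (chart_at one) : 'rV[R]_n -> R^o).

(** Normality makes the right coset through [g] equal to the left coset [g K]. *)
Lemma right_coset_ltrans x : K x <-> right_coset K g0 (g * x)%g.
Proof.
have [K1 KM KV KJ] := Knormal; have [k Kk ->] := Sg; split.
  move=> Kx; exists (k * (g0 * x * g0^-1))%g; first by apply: KM => //; exact: KJ.
  by rewrite !mulgA mulgVK.
move=> [k' Kk' E]; have -> : x = (g0^-1 * (k^-1 * k') * (g0^-1)^-1)%g.
  by rewrite invgK -!mulgA -E -!mulgA !mulKg.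
by apply/KJ/KM => //; exact: KV.
Qed.

Lemma near_ltrans (P : set G) : (\forall y \near g, P y) ->
  \forall u \near e, P (g * cinv (chart_at one) u)%g.
Proof.
move=> Pg; apply: (near_cinv (P := fun y => P (g * y)%g) (mem_chart_at one)).
by apply: (@ltrans_continuous _ _ _ g one); rewrite /ltrans mulg1.
Qed.

Lemma coset_fun_chart : {near e,
  (s \o cinv (chart_at g) : 'rV[R]_n -> R^o) \o local_rep (ltrans g) one =1 f}.
Proof.
apply: filterS (near_ltrans (near_chart_at_id g)) => u gu.
by rewrite ltrans_local_rep /chart_mul /= chart_at_idK chart_atK.
Qed.

Lemma coset_fun_near : \forall u \near e,
  differentiable f u /\ (K (cinv (chart_at one) u) <-> f u = 0).
Proof.
have [U [Uo Ug sU US _]] := sdef.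
have sd := smooth_near_differentiable (sU _ Ug).
have phid := smooth_near_differentiable (ltrans_smooth g).
have phic : local_rep (ltrans g) one @ e --> chart_at g g.
  rewrite -[X in _ --> X]ltrans_local_rep1.
  exact/differentiable_continuous/(nbhs_singleton phid).
have sdu : \forall u \near e, differentiable
    (s \o cinv (chart_at g) : 'rV[R]_n -> R^o) (local_rep (ltrans g) one u).
  exact: (phic _ sd).
(* Differentiability at every [u] near [e] requires the two expressions to agree on a neighbourhood
   of each such [u]. *)
have fEn := near_join coset_fun_chart.
near=> u; split; last first.
  apply: iff_trans (right_coset_ltrans _) _; apply: US.
  by near: u; apply: near_ltrans; exact: open_nbhs_nbhs.
have fEu : {near u, (s \o cinv (chart_at g) : 'rV[R]_n -> R^o) \o
   local_rep (ltrans g) one =1 f} by near: u.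
apply: near_eq_differentiable fEu _.
by apply: differentiable_comp; near: u.
Unshelve. all: by end_near. Qed.

Lemma diff_coset_fun v : 'd f e v = pairing W v.
Proof.
have [U [Uo Ug sU US _]] := sdef.
have sd := nbhs_singleton (smooth_near_differentiable (sU _ Ug)).
have phid := ltrans_differentiable g.
rewrite -ltrans_local_rep1 in sd.
have cd := differentiable_comp phid sd.
rewrite (near_eq_diff coset_fun_chart cd) (diff_comp phid sd) /=.
rewrite ltrans_local_rep1 diff_dfun /pairing.
by rewrite -(deriveE _ phid) (deriveEjacobian _ phid) -mulmxA.
Qed.

(** Along a curve in [K] through 1 the function [f] vanishes near time 0, so its derivative there,
    which is [W] applied to the velocity, is 0 by uniqueness of limits. *)
Lemma annihilator_pullback_dfun (c : R) : annihilator K (c *: W).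
Proof.
move=> v [k [k0 Kk [kc kv]]].
rewrite /pairing -scalemxAr mxE -[(v *m W) 0 0]/(pairing W v) -diff_coset_fun.
have fd : differentiable f (chart_at (k 0) (k 0)).
  by rewrite k0; have [] := nbhs_singleton coset_fun_near.
have [K1 _ _ _] := Knormal.
have fv := derivative_within_comp fd kv.
rewrite k0 in fv kc.
have fv0 : derivative_within setT (fun=> 0 : R^o) 0 ('d f e v).
  apply: derivative_within_near_eq fv; last first.
    by rewrite k0; apply/(nbhs_singleton coset_fun_near).2; rewrite chart_at_idK.
  have kc0 : k @ (0 : R) --> one by move: kc; rewrite withinET.
  have h1 := kc0 _ (near_chart_at_id one).
  have h2 := kc0 _ (near_cmap (mem_chart_at one) coset_fun_near).
  rewrite withinET; apply: cvg_within.
  near=> tau; have k1 : cdom (chart_at one) (k tau) by near: tau.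
  have [_ fK] : differentiable f (chart_at one (k tau)) /\
     (K (cinv (chart_at one) (chart_at one (k tau))) <->
      f (chart_at one (k tau)) = 0).
    by near: tau.
  by apply/fK; rewrite chart_atK.
have -> : 'd f e v = 0; last by rewrite mulr0.
have l0 : derivative_within setT (fun=> 0 : R^o) 0 0.
  rewrite /derivative_within.
  have -> : (fun r : R => (r - 0)^-1 *: (0 - 0 : R^o)) = cst 0.
    by apply/funext => r; rewrite subrr scaler0.
  exact: cvg_cst.
move: l0 fv0; rewrite /derivative_within withinET => l0 fv0.
exact: (cvg_unique _ fv0 l0).
Unshelve. all: by end_near. Qed.

(** Every vector in the kernel of [W] is the velocity of a curve in the zero set of [f], hence
    tangent to [K]; so [d] vanishes on that kernel. *)
Lemma annihilator_line d : W != 0 -> annihilator K d -> exists c, d = c *: W.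
Proof.
move=> W0 Kd; apply: line_of_annihilator => // v Wv; apply: Kd.
have [K1 _ _ _] := Knormal.
have [w Ww] := exists_pairing1 W0.
(* The chart conditions keep the whole curve inside the chart, so that reading its image in [G] back
   in coordinates returns it at all times. *)
pose T := [set u | K (cinv (chart_at one) u) /\
   cdom (chart_at one) (cinv (chart_at one) u) /\
   chart_at one (cinv (chart_at one) u) = u].
have [||||||z [z0 zT zc zd]] := @level_set_curve R 'rV[R]_n T f e v w.
- by rewrite /T /= chart_at_idK; split => //; split => //; exact: mem_chart_at.
- have h := near_cinv (mem_chart_at one) (near_chart_at_id one).
  apply: filterS3 _ coset_fun_near h (near_chart_at_cinvK (mem_chart_at one)).
  by move=> u [_ fK] u1 uK; split=> [[/fK]|/fK].
- by apply: filterS coset_fun_near => u [/differentiable_continuous].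
- by have [] := nbhs_singleton coset_fun_near.
- by rewrite diff_coset_fun.
- by rewrite diff_coset_fun.
have c0 : cinv (chart_at one) (z 0) = one by rewrite z0 chart_at_idK.
exists (cinv (chart_at one) \o z); split => //=.
  by move=> t; have [] := zT t.
split; rewrite /= c0.
  rewrite withinET; apply: (cvg_comp z _ zc); rewrite z0.
  have : cinv (chart_at one) @ e --> cinv (chart_at one) e.
    exact: (cinv_continuous (mem_chart_at one)).
  by rewrite chart_at_idK.
have -> : (fun t => chart_at one (cinv (chart_at one) (z t))) = z.
  by apply/funext => t; have [_ []] := zT t.
exact: zd.
Qed.

End Coset.

(** * Limits at impact times, invariance of the cometric, and the equations of motion *)

Lemma within_dnbhs_sides (R : realType) (I : set R) (t : R) :
  within I t^'- --> within I t^' /\ within I t^'+ --> within I t^'.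
Proof.
split=> P; rewrite /within /= => tP; move: tP;
  apply: (@filterS _ (nbhs t)) => u tP ut;
  by apply: tP; rewrite ?(lt_eqF ut) ?(gt_eqF ut).
Qed.

Lemma ct_velocity_within_cvg (R : realType) (n : nat) (M : manifoldType R n)
    (I : set R) (c : R -> M * 'cV[R]_n) (t : R) (X : 'rV[R]_n * 'cV[R]_n) :
  ct_velocity_within I c t X -> ct_cvg (within I t^') c (c t).
Proof.
move=> [cc cX]; split; last exact: derivative_within_cvg cX.
apply: cvg_trans cc; apply: cvg_fmap2 => P.
by rewrite /within /=; exact: nbhs_dnbhs.
Qed.

Lemma pullbackD (R : realType) (n l : nat) (M : manifoldType R n)
    (N : manifoldType R l) (f : M -> N) x p r :
  pullback f x (p + r) = pullback f x p + pullback f x r.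
Proof. exact: mulmxDr. Qed.

Lemma pullbackZ (R : realType) (n l : nat) (M : manifoldType R n)
    (N : manifoldType R l) (f : M -> N) x c p :
  pullback f x (c *: p) = c *: pullback f x p.
Proof. by rewrite /pullback -scalemxAr. Qed.

Lemma pullback0 (R : realType) (n l : nat) (M : manifoldType R n)
    (N : manifoldType R l) (f : M -> N) x : pullback f x 0 = 0.
Proof. exact: mulmx0. Qed.

(** Differentiating the invariance of [H] along the fiber removes the potential and leaves the
    cometric. *)
Lemma cometric_left_invariant (R : realType) (n : nat) (G : lieGroupType R n)
    (m : G -> 'M[R]_n) (V : G -> R) (H : G -> 'cV[R]_n -> R)
    (Hnat : natural_hamiltonian m V H) (Hinv : left_invariant H) (g : G) p r :
  cometric m g p r =
  cometric m 1%g (pullback (ltrans g) 1%g p) (pullback (ltrans g) 1%g r).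
Proof.
have [_ Eg] := is_diff_natural_hamiltonian Hnat g p.
have dL := is_diff_mulmx (is_diff_cst (tangent (ltrans g) 1%g) p) (is_diff_id p).
have d1 := is_diff_natural_hamiltonian Hnat 1%g (pullback (ltrans g) 1%g p).
have [_ E1] := is_diff_comp dL d1.
have HE : H g = H 1%g \o (fun y => cst (tangent (ltrans g) 1%g) y *m id y).
  by apply/funext => y; exact: Hinv.
by rewrite -Eg HE E1 /= mul0mx addr0.
Qed.

(** For [ds] the differential of the defining function, this turns the outward condition of the
    guard into the nondegeneracy that [resetP] asks for. *)
Lemma guard_pairing (R : realType) (n : nat) (G : lieGroupType R n)
    (m : G -> 'M[R]_n) (V : G -> R) (H : G -> 'cV[R]_n -> R)
    (Hnat : natural_hamiltonian m V H) (Hinv : left_invariant H) (g : G) p X :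
  hamiltonian_vector H (g, p) X ->
  forall ds, pairing ds X.1 = cometric m g ds p.
Proof.
move=> /(hamiltonian_vectorE Hnat Hinv)[-> _] ds.
rewrite (cometric_sym Hnat) (cometric_left_invariant Hnat Hinv).
by rewrite /pairing /tangent_map -mulmxA.
Qed.

Lemma quotient_projection_ltrans (R : realType) (n l : nat) (G : lieGroupType R n)
    (K : set G) (M : manifoldType R l) (pi : G -> M) (x y : G) :
  quotient_projection K pi -> pi x = pi y -> pi \o ltrans x = pi \o ltrans y.
Proof.
move=> [_ _ _ piK] /piK[k Kk xy]; apply/funext => z.
by apply/piK; exists k => //; rewrite xy /ltrans mulgA.
Qed.

(** The velocity induced on the quotient depends only on the coset, which allows the value of a
    section to replace the actual group element. *)
Lemma tangent_quotient_ltrans (R : realType) (n l : nat) (G : lieGroupType R n)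
    (K : set G) (M : manifoldType R l) (pi : G -> M) (x y : G) :
  quotient_projection K pi -> pi x = pi y -> forall v,
  tangent_map pi x (tangent_map (ltrans x) 1%g v) =
  tangent_map pi y (tangent_map (ltrans y) 1%g v).
Proof.
move=> piQ /(quotient_projection_ltrans piQ) pixy.
have [pis _ _ _] := piQ.
have T z : tangent (pi \o ltrans z) 1%g = tangent (ltrans z) 1%g *m tangent pi z.
  have zE : ltrans z 1%g = z by rewrite /ltrans mulg1.
  have [_ pid] := pis z I.
  have {}pid := nbhs_singleton (smooth_near_differentiable pid).
  have := tangent_comp (@ltrans_continuous _ _ _ z 1%g) (ltrans_differentiable z).
  by move=> /(_ _ _ pi); rewrite zE; apply.
have E := etrans (esym (T x)) (etrans (congr1 (fun f => tangent f 1%g) pixy) (T y)).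
have aux a (v : 'rV[R]_n) (A C : 'M[R]_n) (B D : 'M[R]_(n, a)) :
    A *m B = C *m D -> v *m A *m B = v *m C *m D.
  by move=> ABCD; rewrite -!mulmxA ABCD.
by move=> v; exact: aux E.
Qed.

Theorem theorem3p22 (R : realType) (n : nat) (G : lieGroupType R n)
    (K : set G) (hK : closed_normal_lie_subgroup_codim1 K) (g0 : G)
    (M : manifoldType R 1) (pi : G -> M) (hpi : quotient_projection K pi)
    (m : G -> 'M[R]_n) (V : G -> R) (H : G -> 'cV[R]_n -> R)
    (s : G -> G -> R)
    (hsys : mechanical_impact_system m V H (right_coset K g0) s)
    (hinv : left_invariant H)
    (I : set R) (hI : is_interval I) (g : R -> G) (p : R -> 'cV[R]_n)
    (hgp : hybrid_trajectory m H (right_coset K g0) s I (fun t => (g t, p t)))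
    (U : set M) (sigma : M -> G) (hsigma : local_section pi U sigma) :
  let Sigma := right_coset K g0 in
  let h : 'cV[R]_n -> R := H 1%g in
  let zeta := fun t => pullback (ltrans (g t)) 1%g (p t) in
  let q := fun t => pi (g t) in
  (forall t, I t -> ~ (pi @` Sigma) (q t) ->
     derivative_within I zeta t (ad_star G (codifferential h (zeta t)) (zeta t))
     /\ (U (q t) ->
         velocity_within I q t
           (tangent_map pi (sigma (q t))
              (tangent_map (ltrans (sigma (q t))) 1%g
                 (sharp m 1%g (zeta t)))))) /\
  (forall t, I t -> (pi @` Sigma) (q t) ->
     [/\ zeta @ within I t^'- --> zeta t,
         q @ within I t^'- --> q t,
         q @ within I t^'+ --> q t
       & exists d : 'cV[R]_n,
           [/\ impulse K h (zeta t) d,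
               zeta @ within I t^'+ --> zeta t + d,
               d <> 0 <-> guard H Sigma s (g t, p t)
             & guard H Sigma s (g t, p t) ->
               forall d', impulse K h (zeta t) d' -> d' <> 0 -> d' = d]]).
Proof.
move=> Sigma h zeta q.
have [Knorm pis piK] : [/\ normal_subgroup K, smooth_map_on setT pi
    & forall x y, pi x = pi y <-> right_coset K x y].
  by have [_ ? _] := hK; have [? _ _ ?] := hpi.
have [Hnat Sor] := hsys.
(* The coset is a union of fibers of [pi], so its image in the quotient detects membership. *)
have SigmaE t : (pi @` Sigma) (q t) -> Sigma (g t).
  move=> [x [k Kk ->] /piK[k' Kk' E]]; have [_ KM _ _] := Knorm.
  by exists (k' * k)%g; [exact: KM|rewrite -mulgA].
split=> t It.
  move=> nSigma.
  have ng : ~ guard H Sigma s (g t, p t).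
    by move=> [Sg _]; apply: nSigma; exists (g t).
  have [X HX cX] := (hgp t It).1 ng.
  split.
    rewrite -(ad_star_momentum Hnat hinv HX).
    exact: (ct_velocity_within_momentum cX).
  move=> Uq; have [_ _ sq] := hsigma.
  have gX : velocity_within I g t X.1.
    have [gc Xd] := cX; split => //.
    have [fd fE] := is_diff_fst (ct_chart (g t) (g t, p t)).
    by have := derivative_within_comp fd Xd; rewrite fE.
  have [pic pid] := pis (g t) Logic.I.
  have := velocity_within_comp pic
    (nbhs_singleton (smooth_near_differentiable pid)) gX.
  have [-> _] := hamiltonian_vectorE Hnat hinv HX.
  move=> qv; have E := tangent_quotient_ltrans hpi (esym (sq _ Uq)).
  exact: (eq_ind _ (velocity_within I q t) qv _ (E _)).
move=> /SigmaE Sg.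
have [pic _] := pis (g t) Logic.I.
(* On the coset with a momentum outside the guard, for instance just after a reset or at a
   tangential contact, the motion is continuous and the jump is 0. *)
have [guardt|ng] := pselect (guard H Sigma s (g t, p t)); last first.
  have [X HX cX] := (hgp t It).1 ng.
  have cc := ct_velocity_within_cvg cX.
  have zc : zeta @ within I t^' --> zeta t by exact: ct_cvg_momentum cc.
  have qc : q @ within I t^' --> q t.
    by have [gc _] := cc; exact: (cvg_comp _ _ gc).
  have [L1 L2] := within_dnbhs_sides I t.
  split; [exact: cvg_trans (cvg_fmap2 L1) zc|exact: cvg_trans (cvg_fmap2 L1) qc
         |exact: cvg_trans (cvg_fmap2 L2) qc|].
  exists 0; split; rewrite ?addr0 //.
  - by split; [move=> xi _; rewrite /pairing mulmx0 mxE|rewrite addr0].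
  - exact: cvg_trans (cvg_fmap2 L2) zc.
have [cl cr] := (hgp t It).2 guardt.
set x := g t in Sg pic guardt cl cr *; set ds := dfun (s x) x.
pose W := pullback (ltrans x) 1%g ds.
have [_ [X HX dsX]] := guardt.
have C := guard_pairing Hnat hinv HX.
have C0 : cometric m x ds (p t) != 0 by rewrite -C lt0r_neq0.
have sdef : defining_function Sigma x (s x) by have [/(_ _ Sg)] := Sor.
have W0 : W != 0.
  apply: contraNneq C0 => W0; rewrite (cometric_left_invariant Hnat hinv) -/W W0.
  by rewrite /cometric trmx0 !mul0mx mxE.
(* This is the multiplier of the reset; pulled back to the identity, the jump of the covector
   becomes [- lam *: W]. *)
pose lam := 2 * (cometric m x ds (p t) / cometric m x ds ds).
have rE : reset m s (x, p t) = (x, p t - lam *: ds) by [].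
have [corner pp'] := (resetP (p t - lam *: ds) Hnat C0).2 (esym rE).
have zE c : pullback (ltrans x) 1%g (p t + c *: ds) = zeta t + c *: W.
  by rewrite pullbackD pullbackZ.
have hE c : h (zeta t + c *: W) = H x (p t + c *: ds) by rewrite hinv zE.
have h0 : h (zeta t) = H x (p t) by rewrite hinv.
split.
- exact: ct_cvg_momentum cl.
- by have [gl _] := cl; apply: (cvg_comp _ _ gl); exact: pic.
- by have [gr _] := cr; apply: (cvg_comp _ _ gr); exact: pic.
exists (- lam *: W); split.
- split; first exact: (annihilator_pullback_dfun Knorm Sg sdef).
  by rewrite hE h0 scaleNr; have [] := corner.
- have := ct_cvg_momentum _ cr.
  by rewrite rE /= -scaleNr zE; apply.
- split=> // _; move=> /eqP; rewrite scaler_eq0 (negPf W0) orbF oppr_eq0 => /eqP l0.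
  by apply: pp'; rewrite l0 scale0r subr0.
(* Any nonzero impulse is a multiple [c *: W], and preserving the energy makes [p t + c *: ds] a
   nontrivial solution of the corner conditions, hence the reset momentum. *)
- move=> _ d' [/(annihilator_line Knorm Sg sdef W0)[c ->]] hd' d'0.
  have ds0 : ds != 0 by apply: contraNneq W0 => ds0; rewrite /W ds0 pullback0.
  have c0 : c != 0 by apply: contra_notN d'0 => /eqP ->; rewrite scale0r.
  have rc : (x, p t + c *: ds) = reset m s (x, p t).
    apply/(resetP _ Hnat C0); split; last first.
      move/eqP; rewrite -subr_eq0 addrC addKr scaler_eq0 (negPf c0).
      by rewrite (negPf ds0).
    split; first by rewrite -hE -h0 hd'.
    by exists c; rewrite addrC addKr.
  move: rc; rewrite rE => -[/addrI/eqP]; rewrite -scaleNr -subr_eq0 -scalerBl.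
  by rewrite scaler_eq0 (negPf ds0) orbF subr_eq0 => /eqP ->.
Qed.
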